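(* Let $E_1,E_2$ be Hilbert C*-modules over a unital C*-algebra $\mathscr A$ and consider the self-adjoint block operator $$H=\begin{pmatrix} A & B \\ {B^*} & C \end{pmatrix}\in\mathcal L(E_1\oplus E_2)$$ with $A=A^*\ge aI_{E_1}$ and $C=C^*\ge cI_{E_2}$ for some scalars $a,c>0$, and $B\in\mathcal L(E_2,E_1)$. Suppose that for some $0\le\gamma<1$, $$\|\langle By,x\rangle\|^2\le\gamma\,\|\langle Ax,x\rangle\|\,\|\langle Cy,y\rangle\|\qquad(x\in E_1,\ y\in E_2).$$ Then $$H\ge\delta\,I_{E_1\oplus E_2}\qquad\text{with}\qquad\delta:=\min\{a(1-\sqrt\gamma)^2,\ c(1-\sqrt\gamma)^2\}>0.$$ In particular, the spectral gap of $H$ above its infimum is at least $\delta$, in the sense that $\sigma(H)\subseteq[\delta,\infty)$.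
   Context: All Hilbert C*-modules are right modules over the unital C*-algebra $\mathscr A$, with $\mathscr A$-valued inner product $\langle\cdot,\cdot\rangle$ linear in the second variable. $\mathcal L(E,F)$ denotes the adjointable operators $E\to F$, $\mathcal L(E)=\mathcal L(E,E)$; $S\ge R$ for self-adjoint $S,R\in\mathcal L(E)$ means $S-R$ is positive. $E_1\oplus E_2$ carries the canonical inner product. $\sigma(H)$ is the spectrum of $H$. *)

(* Defs.v *)
(* MathComp, with the real numbers and classical sets of MathComp-Analysis. *)
From HB Require Import structures.
From mathcomp Require Import all_boot all_order all_algebra.
From mathcomp Require Import complex.
From mathcomp Require Import classical_sets reals.

Set Implicit Arguments.
Unset Strict Implicit.
Unset Printing Implicit Defensive.

Import Order.TTheory GRing.Theory Num.Theory.

Local Open Scope classical_set_scope.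
Local Open Scope complex_scope.
Local Open Scope ring_scope.

(* The norm is a separate field [cnorm] because the NormedModule and Ring
   hierarchies have no join other than the numeric domains. [algType] makes the
   algebra associative, unital and nonzero. *)
HB.mixin Record isCStarAlgebra (R : realType) A of GRing.Algebra R[i] A := {
  star : A -> A;
  cnorm : A -> R;
  starK : involutive star;
  starD : forall x y, star (x + y) = star x + star y;
  starZ : forall (k : R[i]) x, star (k *: x) = conjc k *: star x;
  starM : forall x y, star (x * y) = star y * star x;
  cnorm_ge0 : forall x, 0 <= cnorm x;
  cnorm_eq0 : forall x, cnorm x = 0 -> x = 0;
  cnormD_le : forall x y, cnorm (x + y) <= cnorm x + cnorm y;
  cnormZ : forall (k : R[i]) x, cnorm (k *: x) = complex.Re `|k| * cnorm x;
  cnormM_le : forall x y, cnorm (x * y) <= cnorm x * cnorm y;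
  cnorm_star_mul : forall x, cnorm (star x * x) = cnorm x ^+ 2;
  ccomplete : forall u : nat -> A,
    (forall e : R, 0 < e -> exists N, forall m n,
       (N <= m)%N -> (N <= n)%N -> cnorm (u m - u n) < e) ->
    exists l, forall e : R, 0 < e -> exists N, forall n,
       (N <= n)%N -> cnorm (u n - l) < e
}.

#[short(type="cstarAlgType")]
HB.structure Definition CStarAlgebra (R : realType) :=
  {A of GRing.Algebra R[i] A & isCStarAlgebra R A}.

Section cstar.
Variables (R : realType) (A : cstarAlgType R).

Definition cinvertible (x : A) : Prop := exists y : A, y * x = 1 /\ x * y = 1.

Definition cspectrum (x : A) : set R[i] := [set z | ~ cinvertible (x - z%:A)].

(* In the order of R[i], 0 <= z says that z is real and nonnegative. *)
Definition cpositive (x : A) : Prop :=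
  star x = x /\ cspectrum x `<=` [set z | 0 <= z].

Lemma star1 : star (1 : A) = 1.
Proof. by rewrite -[LHS]mulr1 -[X in _ * X]starK -starM mulr1 starK. Qed.

Lemma star_scalar (k : R[i]) : star (k%:A : A) = (conjc k)%:A.
Proof. by rewrite starZ star1. Qed.

Lemma scalar_comm (k : R[i]) (x : A) : k%:A * x = x * k%:A.
Proof. by rewrite mulr_algl mulr_algr. Qed.

End cstar.

(* A right A-module is a left module over the converse ring A^c: [a *: x] is
   the right action x.a, and a complex number k acts as [k%:A *: x]. Linearity
   of [inner] in its second variable over the complex numbers is contained in
   [innerZr]. *)
HB.mixin Record isInnerModule (R : realType) (A : cstarAlgType R) E
    of GRing.Lmodule A^c E := {
  inner : E -> E -> A;
  innerDr : forall x y z, inner x (y + z) = inner x y + inner x z;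
  innerZr : forall x (a : A) y, inner x ((a : A^c) *: y) = inner x y * a;
  star_inner : forall x y, star (inner x y) = inner y x
}.

(* Modules with an A-valued form, positive or not. Adjointable operators are
   defined at this level, so that the orthogonal sum of two Hilbert modules can
   be used without first proving that it is again a Hilbert module. *)
#[short(type="innerModType")]
HB.structure Definition InnerModule (R : realType) (A : cstarAlgType R) :=
  {E of GRing.Lmodule A^c E & isInnerModule R A E}.

Definition hnorm (R : realType) (A : cstarAlgType R) (E : innerModType A)
    (x : E) : R :=
  Num.sqrt (cnorm (inner x x)).

HB.mixin Record isHilbertModule (R : realType) (A : cstarAlgType R) E
    of InnerModule R A E := {
  inner_ge0 : forall x : E, cpositive (inner x x);
  inner_eq0 : forall x : E, inner x x = 0 -> x = 0;
  hcomplete : forall u : nat -> E,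
    (forall e : R, 0 < e -> exists N, forall m n,
       (N <= m)%N -> (N <= n)%N -> hnorm (u m - u n) < e) ->
    exists l, forall e : R, 0 < e -> exists N, forall n,
       (N <= n)%N -> hnorm (u n - l) < e
}.

#[short(type="hilbertModType")]
HB.structure Definition HilbertModule (R : realType) (A : cstarAlgType R) :=
  {E of InnerModule R A E & isHilbertModule R A E}.

Section inner_theory.
Variables (R : realType) (A : cstarAlgType R) (E : innerModType A).
Implicit Types x y z : E.

Lemma innerDl x y z : inner (x + y) z = inner x z + inner y z.
Proof. by rewrite -star_inner innerDr starD !star_inner. Qed.

Lemma inner_scalel (k : R[i]) x y :
  inner (((k%:A : A) : A^c) *: x) y = inner x (((conjc k)%:A : A^c) *: y).
Proof.
by rewrite -star_inner !innerZr starM star_scalar star_inner scalar_comm.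
Qed.

End inner_theory.

Section orthogonal_sum.
Variables (R : realType) (A : cstarAlgType R) (E1 E2 : innerModType A).

Definition sum_inner (x y : E1 * E2) : A :=
  inner x.1 y.1 + inner x.2 y.2.

Fact sum_innerDr x y z : sum_inner x (y + z) = sum_inner x y + sum_inner x z.
Proof. by rewrite /sum_inner !innerDr addrACA. Qed.

Fact sum_innerZr x (a : A) y :
  sum_inner x ((a : A^c) *: y) = sum_inner x y * a.
Proof. by rewrite /sum_inner !innerZr mulrDl. Qed.

Fact star_sum_inner x y : star (sum_inner x y) = sum_inner y x.
Proof. by rewrite /sum_inner starD !star_inner. Qed.

HB.instance Definition _ :=
  isInnerModule.Build R A (E1 * E2)%type sum_innerDr sum_innerZr star_sum_inner.

End orthogonal_sum.

(* L(E, F). On Hilbert modules and their orthogonal sums the adjoint is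
   determined by the operator, and both are automatically A-linear and
   bounded. *)
Record adjointable (R : realType) (A : cstarAlgType R) (E F : innerModType A) :=
  Adjointable {
    adj_fun :> E -> F;
    adj_adj : F -> E;
    adjP : forall x y, inner (adj_fun x) y = inner x (adj_adj y)
  }.

Section operators.
Variables (R : realType) (A : cstarAlgType R).
Implicit Types E F : innerModType A.

Fact adjoint_subproof E F (T : adjointable E F) y x :
  inner (adj_adj T y) x = inner y (T x).
Proof. by rewrite -star_inner -adjP star_inner. Qed.

Definition adjoint E F (T : adjointable E F) : adjointable F E :=
  Adjointable (adjoint_subproof T).

Definition scalar_op E (k : R[i]) : adjointable E E :=
  Adjointable (@inner_scalel R A E k).

Fact opp_op_subproof E F (T : adjointable E F) x y :
  inner (- T x) y = inner x (- adj_adj T y).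
Proof.
have N1 (G : innerModType A) (z : G) : - z = ((-1)%:A : A^c) *: z.
  by rewrite scaleNr scale1r scaleN1r.
by rewrite !N1 inner_scalel !innerZr rmorphN1 adjP.
Qed.

Fact sub_op_subproof E F (S T : adjointable E F) x y :
  inner (S x - T x) y = inner x (adj_adj S y - adj_adj T y).
Proof. by rewrite innerDl innerDr opp_op_subproof adjP. Qed.

Definition sub_op E F (S T : adjointable E F) : adjointable E F :=
  Adjointable (sub_op_subproof S T).

Definition selfadjoint E (T : adjointable E E) : Prop := T =1 adjoint T.

Definition invertible_op E (T : adjointable E E) : Prop :=
  exists S : adjointable E E, cancel T S /\ cancel S T.

Definition spectrum E (T : adjointable E E) : set R[i] :=
  [set z | ~ invertible_op (sub_op T (scalar_op E z))].

(* Positivity in the C*-algebra L(E), in the same sense as [cpositive]. *)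
Definition positive_op E (T : adjointable E E) : Prop :=
  selfadjoint T /\ spectrum T `<=` [set z | 0 <= z].

Definition op_ge E (S T : adjointable E E) : Prop := positive_op (sub_op S T).

Section block.
Variables (E1 E2 : innerModType A).
Variables (T11 : adjointable E1 E1) (T12 : adjointable E2 E1).
Variables (T21 : adjointable E1 E2) (T22 : adjointable E2 E2).

Definition block_fun (x : E1 * E2) : E1 * E2 :=
  (T11 x.1 + T12 x.2, T21 x.1 + T22 x.2).

Definition block_adj (x : E1 * E2) : E1 * E2 :=
  (adj_adj T11 x.1 + adj_adj T21 x.2, adj_adj T12 x.1 + adj_adj T22 x.2).

Fact block_subproof x y : inner (block_fun x) y = inner x (block_adj y).
Proof.
rewrite /inner/= /sum_inner !innerDl !innerDr !adjP.
by rewrite addrACA.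
Qed.

Definition block_op : adjointable (E1 * E2)%type (E1 * E2)%type :=
  Adjointable block_subproof.

End block.

Lemma block_selfadjoint (E1 E2 : innerModType A) (T11 : adjointable E1 E1)
    (T12 : adjointable E2 E1) (T22 : adjointable E2 E2) :
  selfadjoint T11 -> selfadjoint T22 ->
  selfadjoint (block_op T11 T12 (adjoint T12) T22).
Proof.
by move=> s1 s2 x; rewrite /= /block_fun /block_adj /= (s1 x.1) (s2 x.2).
Qed.

End operators.

(* Main.v *)
Require Import Defs.
From HB Require Import structures.
From mathcomp Require Import all_boot all_order all_algebra.
From mathcomp Require Import complex.
From mathcomp Require Import boolp classical_sets reals.
From mathcomp Require Import zify lra.

Set Implicit Arguments.
Unset Strict Implicit.
Unset Printing Implicit Defensive.

Import Order.TTheory GRing.Theory Num.Theory.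

Local Open Scope classical_set_scope.
Local Open Scope complex_scope.
Local Open Scope ring_scope.

(** Why the theorem holds.  Put s := sqrt gamma.  If l < delta is real, then
    A' := A - l and C' := C - l are positive and invertible, and the bound on
    [inner (B y) x] persists with A', C' in place of A, C and a constant
    rho < 1 in place of gamma, because A <= kappa A' in the order of forms with
    s kappa < 1, and likewise for C ([shift_upper]).  Eliminating the first component from the
    equation (H - l) (x, y) = (f, g) leaves the equation y - T y = v on E2 with
    T := C'^-1 B^* A'^-1 B.  Inserting x := A'^-1 B y in the bound shows that
    T contracts the form y |-> norm of <C' y, y> by the factor rho, so that a
    Neumann series solves the equation ([block_surjective]).
    Since H is selfadjoint, H - z is surjective for nonreal z as well
    ([symmetric_nonreal_surjective]), and surjectivity of an operator and of
    its adjoint gives an adjointable inverse ([surjective_invertible]).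

    The hypotheses A >= a and C >= c are spectral, whereas the argument uses
    that <(A - a) x, x> is a positive element of the algebra, and that norms
    are monotone on positive elements.  Both are derived from elementary norm
    identities.

    In the algebra, a selfadjoint k of norm 1 satisfies
      2 |k u| <= |(1 + k^2) u|     for selfadjoint u commuting with k,
    because (1 + k^2)^2 = (1 - k^2)^2 + 4 k^2.  Applied to the powers
    k^(2^j), the inequality telescopes to
      2^n |(1 - k^2) k^(2^n)| <= |(1 - k^(2^(n+1))) k| <= 2,
    so that 1 - k^2 is not invertible: the norm or its opposite is a spectral
    value ([not_cinvertible_pm]).  Hence spectral positivity of p is equivalent
    to |t - p| <= t for some t ([cpositiveP]), a condition stable under sums;
    monotonicity of the norm ([cnorm_le_add]) and the Cauchy-Schwarz inequality
    ([cauchy_schwarz]) follow.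

    The same telescoping argument, applied to vectors, shows that a positive
    operator T satisfies |t - T| <= t for some t
    ([positive_op_contraction]); it uses that adjointable operators are bounded
    ([adjointable_bounded]).  Finally 1 - K = (1 - K)^2 / 2 + (1 - K^2) / 2,
    iterated, writes <x - K x, x> as a sum of elements <z, z> up to an
    arbitrarily small error when |K| <= 1, which makes the form of T positive
    ([positive_op_form]). *)

(** * Neumann series in a complete norm *)

Section real_estimates.
Variable R : realType.

Lemma expr_lt_eps (r e : R) : 0 <= r -> r < 1 -> 0 < e -> exists n, r ^+ n < e.
Proof.
move=> r0 r1 e0; have [->|rn0] := eqVneq r 0; first by exists 1%N;
  rewrite expr1.
have rp : 0 < r by rewrite lt0r rn0.
pose d := r^-1 - 1.
have d0 : 0 < d by rewrite subr_gt0 invf_gt1.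
have [n hn] : exists n : nat, e^-1 / d < n%:R.
  by exists (Num.bound (e^-1 / d)); apply: archi_boundP;
    rewrite divr_ge0 ?invr_ge0 ?ltW.
exists n; rewrite -ltf_pV2 ?posrE ?exprn_gt0// -exprVn.
have -> : r^-1 = 1 + d by rewrite /d addrC subrK.
have bern : forall m, 1 + m%:R * d <= (1 + d) ^+ m.
  elim=> [|m IH]; first by rewrite mul0r addr0 expr0.
  rewrite exprS -natr1; have m0 : 0 <= (m%:R : R) by [].
  apply: le_trans (_ : (1 + d) * (1 + m%:R * d) <= _).
    have := mulr_ge0 m0 (sqr_ge0 d); nra.
  by rewrite ler_wpM2l//; lra.
apply: lt_le_trans (bern n).
by move: hn; rewrite ltr_pdivrMr//; lra.
Qed.

Lemma geom_lt_eps (c r e : R) : 0 <= r -> r < 1 -> 0 < e ->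
  exists N, forall n, (N <= n)%N -> c * r ^+ n < e.
Proof.
move=> r0 r1 e0; have c0 : 0 < `|c| + 1 by rewrite ltr_wpDl.
have [N hN] := expr_lt_eps r0 r1 (divr_gt0 e0 c0).
exists N => n Nn; apply: le_lt_trans (_ : (`|c| + 1) * r ^+ N < e).
  apply: le_trans (_ : (`|c| + 1) * r ^+ n <= _).
    by rewrite ler_wpM2r ?exprn_ge0//; have := ler_norm c; lra.
  by rewrite ler_wpM2l ?(ltW c0)// ler_wiXn2l// ltW.
by rewrite mulrC -ltr_pdivlMr.
Qed.

End real_estimates.

Section complete_norm.
Variables (R : realType) (V : zmodType) (N : V -> R).

(** A norm on a bare abelian group: this covers at once the algebra and the
    Hilbert modules, which share no normed structure. *)
Definition complete_norm : Prop :=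
  [/\ forall x, 0 <= N x,
      forall x, N x = 0 <-> x = 0,
      forall x y, N (x + y) <= N x + N y,
      forall x, N (- x) = N x
    & forall u : nat -> V,
    (forall e : R, 0 < e -> exists N0, forall m n,
       (N0 <= m)%N -> (N0 <= n)%N -> N (u m - u n) < e) ->
    exists l, forall e : R, 0 < e -> exists N0, forall n,
       (N0 <= n)%N -> N (u n - l) < e].

Hypothesis cN : complete_norm.

Lemma norm_small_eq0 x : (forall e, 0 < e -> N x < e) -> x = 0.
Proof.
case: cN => N0 Nd _ _ _ h; apply/Nd/eqP; rewrite eq_le N0 andbT leNgt.
by apply/negP => /h; rewrite ltxx.
Qed.

(** The rate of convergence is kept: the uniform boundedness argument needs the
    distance from each term to the limit, not only convergence. *)
Lemma geometric_limit (u : nat -> V) (C r : R) : 0 <= r -> r < 1 ->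
  (forall n, N (u n.+1 - u n) <= C * r ^+ n) ->
  exists l, forall n, N (u n - l) <= C / (1 - r) * r ^+ n.
Proof.
case: cN => N0 Nd NT NN Nc r0 r1 hu.
have s0 : 0 < 1 - r by rewrite subr_gt0.
set D := C / (1 - r).
have D0 : 0 <= D.
  by rewrite divr_ge0// ?(ltW s0)//; have := hu 0%N; rewrite expr0 mulr1;
    apply: le_trans.
have dist n j : N (u (n + j)%N - u n) <= D * r ^+ n - D * r ^+ (n + j).
  elim: j => [|j IH]; first by rewrite addn0 !subrr (Nd 0).2.
  have -> : u (n + j.+1)%N - u n = (u (n + j.+1)%N - u (n + j)%N)
    + (u (n + j)%N - u n).
    by rewrite addrA subrK.
  apply: le_trans (NT _ _) _; rewrite addnS; have := hu (n + j)%N.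
  have CD : C = D * (1 - r) by rewrite /D mulfVK// gt_eqF.
  have <- : D * r ^+ (n + j) - D * r ^+ (n + j).+1 = C * r ^+ (n + j).
    by rewrite CD exprS; lra.
  lra.
have dist' n m : (n <= m)%N -> N (u m - u n) <= D * r ^+ n.
  move=> nm; rewrite -(subnKC nm); apply: le_trans (dist _ _) _.
  by have := mulr_ge0 D0 (exprn_ge0 (n + (m - n)) r0); lra.
have symm a b : N (a - b) = N (b - a) by rewrite -NN opprB.
case: (Nc u) => [e e0|l hl].
  have [M hM] := geom_lt_eps D r0 r1 e0.
  exists M => m n Mm Mn; case: (leqP m n) => mn.
    by rewrite symm; apply: le_lt_trans (dist' _ _ mn) (hM _ Mm).
  by apply: le_lt_trans (dist' _ _ (ltnW mn)) (hM _ Mn).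
exists l => n; rewrite leNgt; apply/negP => lt.
case: (hl (N (u n - l) - D * r ^+ n)) => [|M' hM']; first lra.
have := dist' n (maxn M' n) (leq_maxr _ _); have :=
  hM' (maxn M' n) (leq_maxl _ _).
have := NT (u n - u (maxn M' n)) (u (maxn M' n) - l).
by rewrite addrA subrK (symm (u n) (u (maxn M' n))); lra.
Qed.

(** Only the orbit of v has to decay, at a rate whose constant may depend on v.
    Thus the decay may be measured in any quadratic form that dominates a
    multiple of the squared norm. *)
Lemma neumann (T : V -> V) (M C r : R) (v : V) :
  {morph T : x y / x - y} -> (forall x, N (T x) <= M * N x) ->
  0 <= r -> r < 1 -> (forall n, N (iter n T v) <= C * r ^+ n) ->
  exists w, w - T w = v.
Proof.
move=> TB TM r0 r1 hT; have [N0 Nd NT NN _] := cN.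
have symm a b : N (a - b) = N (b - a) by rewrite -NN opprB.
have T0 : T 0 = 0 by have := TB 0 0; rewrite !subrr.
have TN x : T (- x) = - T x by rewrite -sub0r TB T0 sub0r.
have TD x y : T (x + y) = T x + T y by rewrite -{1}(opprK y) TB TN opprK.
pose S n := \sum_(j < n) iter j T v.
have SS n : S n.+1 - S n = iter n T v
  by rewrite /S big_ord_recr /= addrAC subrr add0r.
have TS n : T (S n) = S n.+1 - v.
  elim: n => [|n IH]; first by rewrite /S big_ord0 T0 big_ord1 /= subrr.
  by rewrite -[S n.+1 in LHS](subrK (S n)) SS TD IH -[S n.+2](subrK (S n.+1)) SS
    addrA.
have [|l hl] := @geometric_limit S C r r0 r1; first by move=> n; rewrite SS.
exists l; apply/eqP; rewrite -subr_eq0; apply/eqP;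
  apply: norm_small_eq0 => e e0.
set D := C / (1 - r) in hl.
have [K hK] := geom_lt_eps (D * r + `|M| * D) r0 r1 e0.
apply: le_lt_trans (hK K (leqnn _)).
have -> : l - T l - v = (l - S K.+1) + T (S K - l) by
  rewrite TB TS !addrA subrK -!addrA; congr (_ + _); rewrite addrC.
apply: le_trans (NT _ _) _; rewrite symm mulrDl -mulrA -exprS;
  apply: lerD => //.
apply: le_trans (TM _) _; apply: le_trans (_ : `|M| * N (S K - l) <= _).
  by rewrite ler_wpM2r// ler_norm.
by rewrite -mulrA ler_wpM2l.
Qed.

Lemma neumann_contraction (T : V -> V) (r : R) (v : V) :
  {morph T : x y / x - y} -> (forall x, N (T x) <= r * N x) ->
  0 <= r -> r < 1 -> exists w, w - T w = v.
Proof.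
move=> TB Tr r0 r1; apply: (@neumann T r (N v) r) => // n.
elim: n => [|n IH] /=; first by rewrite expr0 mulr1.
apply: le_trans (Tr _) _; rewrite exprS mulrCA.
by rewrite ler_wpM2l.
Qed.

End complete_norm.

(** * Norms and spectral values in a C*-algebra *)

Section complex_modulus.
Variable R : realType.
Implicit Types (r : R) (z : R[i]).

Lemma Re_norm_real r : complex.Re `|r%:C| = `|r|.
Proof. by rewrite normc_def /= expr0n /= addr0 sqrtr_sqr. Qed.

Lemma Re_norm_imag r : complex.Re `|(0 +i* r)%C| = `|r|.
Proof. by rewrite normc_def /= expr0n /= add0r sqrtr_sqr. Qed.

Lemma Re_normV z : complex.Re `|z^-1| = (complex.Re `|z|)^-1.
Proof.
rewrite normfV normc_def; set w := Num.sqrt _.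
by rewrite (_ : w%:C^-1 = (w^-1)%:C) // fmorphV.
Qed.

Lemma real_complex_eq0 r : (r%:C == 0) = (r == 0).
Proof. by rewrite eq_complex /= eqxx andbT. Qed.

End complex_modulus.

Section cstar_norm.
Variables (R : realType) (AA : cstarAlgType R).
Implicit Types (x y h k p q u : AA) (r s t : R) (z : R[i]).

Lemma cnormZr r x : cnorm (r%:C *: x) = `|r| * cnorm x.
Proof. by rewrite cnormZ Re_norm_real. Qed.

Lemma cnorm0 : cnorm (0 : AA) = 0.
Proof.
by rewrite -(scale0r (0 : AA)) (_ : 0 = (0 : R)%:C)// cnormZr normr0 mul0r.
Qed.

Lemma cnormN x : cnorm (- x) = cnorm x.
Proof.
by rewrite -scaleN1r (_ : -1 = (-1 : R)%:C) ?cnormZr ?normrN1 ?mul1r// rmorphN1.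
Qed.

Lemma cnorm_star x : cnorm (star x) = cnorm x.
Proof.
have le y : cnorm y <= cnorm (star y).
  have [->|y0] := eqVneq (cnorm y) 0; first exact: cnorm_ge0.
  have yp : 0 < cnorm y by rewrite lt0r y0 cnorm_ge0.
  by rewrite -(ler_pM2r yp) -expr2 -cnorm_star_mul cnormM_le.
by apply/eqP; rewrite eq_le le andbT -{2}(starK x) le.
Qed.

Lemma cnorm1 : cnorm (1 : AA) = 1.
Proof.
have n0 : cnorm (1 : AA) != 0.
  by apply/eqP => /cnorm_eq0 /eqP; rewrite oner_eq0.
have := cnorm_star_mul (1 : AA); rewrite star1 mulr1 expr2 => /esym e.
by apply: (mulfI n0); rewrite mulr1.
Qed.

Lemma cnorm_scalar r : cnorm (r%:C%:A : AA) = `|r|.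
Proof. by rewrite cnormZr cnorm1 mulr1. Qed.

Lemma star0 : star (0 : AA) = 0.
Proof. by rewrite -{1}(scale0r (0 : AA)) starZ conjc0 scale0r. Qed.

Lemma starN x : star (- x) = - star x.
Proof. by apply/eqP; rewrite -subr_eq0 opprK -starD addNr star0. Qed.

Lemma starB x y : star (x - y) = star x - star y.
Proof. by rewrite starD starN. Qed.

Lemma star_real r : star (r%:C%:A : AA) = r%:C%:A.
Proof. by rewrite star_scalar conjc_real. Qed.

Lemma starZr r x : star (r%:C *: x) = r%:C *: star x.
Proof. by rewrite starZ conjc_real. Qed.

Lemma cnorm_complete : complete_norm (@cnorm R AA).
Proof.
split; [exact: cnorm_ge0| |exact: cnormD_le|exact: cnormN|exact: ccomplete].
by move=> x; split => [/cnorm_eq0//|->]; exact: cnorm0.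
Qed.

Lemma cinvertible_scalar_sub z x :
  cnorm x < complex.Re `|z| -> cinvertible (z%:A - x).
Proof.
move=> xz; set n := complex.Re `|z| in xz.
have n0 : 0 < n by apply: le_lt_trans xz; exact: cnorm_ge0.
have z0 : z != 0 by apply: contraTneq n0 => z0; rewrite /n z0 normr0 ltxx.
have nV : complex.Re `|z^-1| = n^-1 by exact: Re_normV.
have r0 : 0 <= cnorm x / n by rewrite divr_ge0 ?cnorm_ge0// ltW.
have r1 : cnorm x / n < 1 by rewrite ltr_pdivrMr// mul1r.
have [|y|a ha] := @neumann_contraction R AA (@cnorm R AA) cnorm_complete
    (fun y => z^-1 *: (x * y)) (cnorm x / n) (z^-1%:A) _ _ r0 r1.
- by move=> y y'; rewrite mulrBr scalerBr.
- by rewrite cnormZ nV mulrAC [leRHS]mulrC ler_wpM2l ?invr_ge0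
    ?(ltW n0)// cnormM_le.
have [|y|b hb] := @neumann_contraction R AA (@cnorm R AA) cnorm_complete
    (fun y => z^-1 *: (y * x)) (cnorm x / n) (z^-1%:A) _ _ r0 r1.
- by move=> y y'; rewrite mulrBl scalerBr.
- rewrite cnormZ nV mulrAC [leRHS]mulrC ler_wpM2l ?invr_ge0 ?(ltW n0)// mulrC.
  exact: cnormM_le.
have xa : (z%:A - x) * a = 1.
  apply: (scalerI (invr_neq0 z0)); rewrite -ha mulrBl mulr_algl scalerBr.
  by rewrite scalerA mulVf// scale1r.
have bx : b * (z%:A - x) = 1.
  apply: (scalerI (invr_neq0 z0)); rewrite -hb mulrBr mulr_algr scalerBr.
  by rewrite scalerA mulVf// scale1r.
exists a; split => //.
by have -> : a = b by rewrite -[a]mul1r -bx -mulrA xa mulr1.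
Qed.

Lemma cinvertible_real_sub r x : cnorm x < r -> cinvertible (r%:C%:A - x).
Proof.
move=> xr; apply: cinvertible_scalar_sub.
have r0 : 0 < r by apply: le_lt_trans xr; exact: cnorm_ge0.
by rewrite Re_norm_real gtr0_norm.
Qed.

Lemma cinvertibleM x y : cinvertible x -> cinvertible y -> cinvertible (x * y).
Proof.
move=> [a [ax xa]] [b [yb by_]]; exists (b * a); split.
  by rewrite mulrA -(mulrA b) ax mulr1.
by rewrite mulrA -(mulrA x) by_ mulr1.
Qed.

Lemma cinvertibleZ z x : z != 0 -> cinvertible x -> cinvertible (z *: x).
Proof.
move=> z0 [a [ax xa]]; exists (z^-1 *: a).
by rewrite -!scalerAl -!scalerAr !scalerA mulVf// mulfV// scale1r ax scale1r xa.
Qed.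

Lemma cinvertibleN x : cinvertible x -> cinvertible (- x).
Proof. by move=> [a [ax xa]]; exists (- a); rewrite !mulrNN. Qed.

Lemma cnorm_double x : cnorm (x + x) = 2 * cnorm x.
Proof.
have -> : x + x = (2 : R)%:C *: x by rewrite -mulr2n -scaler_nat rmorph_nat.
by rewrite cnormZr ger0_norm.
Qed.

(** As h and k commute, h^2 + k^2 = w^* w for w := h + i k, and h is the real
    part of w. *)
Lemma cnorm_sqr_sum_ge h k : star h = h -> star k = k -> h * k = k * h ->
  cnorm h ^+ 2 <= cnorm (h * h + k * k).
Proof.
move=> sh sk hk; pose w := h + 'i%C *: k.
have sw : star w = h - 'i%C *: k.
  rewrite /w starD starZ sh sk; congr (_ + _).
  by rewrite -scaleNr; congr (_ *: _); apply/eqP;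
    rewrite eq_complex /= oppr0 !eqxx.
have -> : h * h + k * k = star w * w.
  rewrite sw /w mulrBl !mulrDr -!scalerAl -!scalerAr scalerA hk.
  by rewrite opprD addrA addrK -[('i * 'i)%C]expr2 sqr_i scaleN1r opprK.
rewrite cnorm_star_mul ler_sqr ?nnegrE ?cnorm_ge0//.
have : w + star w = h + h by rewrite sw /w addrACA subrr addr0.
have hh : cnorm (h + h) = 2 * cnorm h.
  exact: cnorm_double.
by have := cnormD_le w (star w); rewrite cnorm_star => le e; move: le;
  rewrite e hh; lra.
Qed.

(** Apply [cnorm_sqr_sum_ge] to 2 k u and (1 - k^2) u, whose squares add up to
    the square of (1 + k^2) u. *)
Lemma cnorm_double_le k u : star k = k -> star u = u -> k * u = u * k ->
  2 * cnorm (k * u) <= cnorm ((1 + k * k) * u).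
Proof.
move=> sk su ku.
have cku : GRing.comm k u by [].
pose q := k * k.
have cqu : GRing.comm q u by apply/commr_sym; apply: commrM.
have cpq : GRing.comm (1 + q) u.
  by apply/commr_sym; apply: commrD; [exact: commr1|exact/commr_sym].
have cmq : GRing.comm (1 - q) u.
  by apply/commr_sym; apply: commrB; [exact: commr1|exact/commr_sym].
have sq : star q = q by rewrite starM sk.
have ckq : GRing.comm k q by apply: commrM.
have ckm : GRing.comm k (1 - q) by apply: commrB => //; exact: commr1.
pose h := k * u + k * u; pose l := (1 - q) * u.
have sku : star (k * u) = k * u by rewrite starM sk su.
have sh : star h = h by rewrite starD sku.
have sl : star l = l by rewrite starM starB star1 sq su -cmq.
have spu : star ((1 + q) * u) = (1 + q) * u
  by rewrite starM starD star1 sq su -cpq.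
have sq2 a : GRing.comm a u -> a * u * (a * u) = a * a * (u * u).
  by move=> ca; rewrite -!mulrA; congr (_ * _); rewrite !mulrA -ca.
have hl : h * l = l * h.
  have e : (k * u) * l = l * (k * u).
    by apply: (@commrM _ (k * u) (1 - q) u); apply/commr_sym;
      apply: commrM => //; apply/commr_sym.
  by rewrite /h mulrDl mulrDr e.
have := cnorm_sqr_sum_ge sh sl hl.
have -> : h * h + l * l = star ((1 + q) * u) * ((1 + q) * u).
  have hh : h * h = (q + q + (q + q)) * (u * u).
    by rewrite /h mulrDl !mulrDr !sq2// !(mulrDl _ _ (u * u)).
  rewrite spu hh /l !sq2// -(mulrDl _ _ (u * u)); congr (_ * _).
  rewrite mulrBl !mulrBr mulrDl (mulrDr q) !mul1r !mulr1 opprB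
    [1 - q + _]addrACA.
  rewrite -opprD; set X := q + q; rewrite [X + X + _]addrC addrA subrK.
  by rewrite [in RHS]addrA -[in RHS](addrA 1) -/X addrAC.
rewrite cnorm_star_mul ler_sqr ?nnegrE ?cnorm_ge0//.
have -> // : cnorm h = 2 * cnorm (k * u).
exact: cnorm_double.
Qed.

Lemma star_expr k n : star k = k -> star (k ^+ n) = k ^+ n.
Proof.
move=> sk; elim: n => [|n IH]; first by rewrite !expr0 star1.
by rewrite exprS starM IH sk -exprSr exprS.
Qed.

(** Each factor 1 + k^(2^j) of (1 - k^(2^(n+1))) / (1 - k^2) yields a factor 2
    by [cnorm_double_le], at the cost of a power k^(2^(j-1)). *)
Lemma cnorm_telescope k n m : star k = k ->
  2 ^+ n * cnorm ((1 - k * k) * k ^+ (m + (2 ^ n).-1))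
  <= cnorm ((1 - k ^+ (2 ^ n.+1)) * k ^+ m).
Proof.
move=> sk; elim: n m => [|n IH] m; first by rewrite expr0 mul1r addn0 expn1
  expr2.
set a := k ^+ (2 ^ n); set b := (1 - k ^+ (2 ^ n.+1)) * k ^+ m.
have cab : GRing.comm (1 - k ^+ (2 ^ n.+1)) (k ^+ m).
  by apply/commr_sym; apply: commrB;
    [exact: commr1|apply: commrX; apply/commr_sym; exact: commrX].
have caa : GRing.comm a b.
  apply: commrM; last by apply/commrX/commr_sym/commrX.
  apply: commrB; first exact: commr1.
  by apply/commrX/commr_sym/commrX.
have sb : star b = b.
  by rewrite starM starB star1 !star_expr// -cab.
have := cnorm_double_le (star_expr _ sk) sb caa.
have aa : a * a = k ^+ (2 ^ n.+1) by rewrite -exprD expnS mul2n addnn.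
have -> : (1 + a * a) * b = (1 - k ^+ (2 ^ n.+2)) * k ^+ m.
  rewrite /b mulrA aa; congr (_ * _); rewrite mulrDl mul1r mulrBr mulr1 -exprD.
  by rewrite addrA subrK addnn -mul2n -expnS.
apply: le_trans.
have -> : a * b = (1 - k ^+ (2 ^ n.+1)) * k ^+ (m + 2 ^ n).
  rewrite caa /b -mulrA -exprD //.
have e : (m + (2 ^ n.+1).-1 = m + 2 ^ n + (2 ^ n).-1)%N.
  by have := expn_gt0 2 n; rewrite expnS; lia.
by rewrite exprS -mulrA ler_pM2l// e IH.
Qed.

Lemma cnorm_expr2 k n : star k = k -> cnorm k = 1 -> cnorm (k ^+ (2 ^ n)) = 1.
Proof.
move=> sk k1; elim: n => [|n IH]; first by rewrite expr1.
by rewrite expnSr exprM expr2 -{1}(star_expr (2 ^ n) sk) cnorm_star_mul IH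
  expr1n.
Qed.

(** With an inverse s, [cnorm_telescope] would bound 2^n |k^(2^n)| = 2^n by
    2 |s| for every n. *)
Lemma not_cinvertible_sqr k : star k = k -> cnorm k = 1 ->
  ~ cinvertible (1 - k * k).
Proof.
move=> sk k1 [s [sl _]].
have bound n : 2 ^+ n <= 2 * cnorm s.
  have := cnorm_telescope n 1 sk.
  have -> : (1 + (2 ^ n).-1 = 2 ^ n)%N by have := expn_gt0 2 n; lia.
  have up : cnorm ((1 - k ^+ (2 ^ n.+1)) * k ^+ 1) <= 2.
    apply: le_trans (cnormM_le _ _) _; rewrite expr1 k1 mulr1.
    apply: le_trans (cnormD_le _ _) _; rewrite cnormN cnorm1 cnorm_expr2//.
  have lo : 1 <= cnorm s * cnorm ((1 - k * k) * k ^+ (2 ^ n)).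
    have := cnormM_le s ((1 - k * k) * k ^+ (2 ^ n)).
    by rewrite mulrA sl mul1r cnorm_expr2.
  move=> h; have n0 : 0 < 2 ^+ n :> R by rewrite exprn_gt0.
  have s0 := cnorm_ge0 s.
  set x := cnorm (_ * k ^+ (2 ^ n)) in lo h.
  have : cnorm s * (2 ^+ n * x) <= cnorm s * 2
    by rewrite ler_wpM2l// (le_trans h).
  have : 2 ^+ n * 1 <= 2 ^+ n * (cnorm s * x) by rewrite ler_wpM2l// ltW.
  by nra.
have := @upper_nthrootP R (2 * cnorm s) _ (leqnn _).
by rewrite ltNge bound.
Qed.

Lemma not_cinvertible_pm k r : star k = k -> cnorm k = r -> 0 < r ->
  cinvertible (r%:C%:A - k) -> cinvertible (r%:C%:A + k) -> False.
Proof.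
move=> sk kr r0 h1 h2.
have rc : r%:C != 0 by rewrite real_complex_eq0 gt_eqF.
have [l [kl sl l1]] : exists l, [/\ k = r%:C *: l, star l = l & cnorm l = 1].
  exists (r^-1%:C *: k); split.
  - by rewrite scalerA -rmorphM /= mulfV ?gt_eqF// scale1r.
  - by rewrite starZr sk.
  - by rewrite cnormZr kr gtr0_norm ?invr_gt0// mulVf// gt_eqF.
apply: (not_cinvertible_sqr sl l1).
have -> : 1 - l * l = (r%:C^-1 ^+ 2) *: ((r%:C%:A - k) * (r%:C%:A + k)).
  rewrite kl.
  rewrite -scalerBr -scalerDr -scalerAl -scalerAr !scalerA.
  have -> : r%:C^-1 ^+ 2 * r%:C * r%:C = 1.
    by rewrite -mulrA -(expr2 r%:C) -exprMn mulVf// expr1n.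
  by rewrite scale1r mulrDr mulr1 mulrBl mul1r addrA subrK.
apply: cinvertibleZ; first by rewrite expf_neq0// invr_eq0.
exact: cinvertibleM.
Qed.

End cstar_norm.

(** * Positive elements of a C*-algebra *)

Section cstar_positive.
Variables (R : realType) (AA : cstarAlgType R).
Implicit Types (x y h k p q u : AA) (r s t : R) (z : R[i]).

(** A form of positivity that is visibly stable under sums; [cpositiveP]
    identifies it with the spectral one. *)
Definition norm_positive p : Prop :=
  star p = p /\ exists t : R, cnorm (t%:C%:A - p) <= t.

Lemma realAD r s : (r + s)%:C%:A = r%:C%:A + s%:C%:A :> AA.
Proof. by rewrite rmorphD /= scalerDl. Qed.

Lemma realAB r s : (r - s)%:C%:A = r%:C%:A - s%:C%:A :> AA.
Proof. by rewrite rmorphB /= scalerBl. Qed.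

Lemma norm_positive_sub h t : star h = h -> cnorm h <= t ->
  norm_positive (t%:C%:A - h).
Proof.
move=> sh ht; split; first by rewrite starB star_real sh.
by exists t; rewrite opprB addrCA subrr addr0.
Qed.

Lemma norm_positive_real t : 0 <= t -> norm_positive (t%:C%:A : AA).
Proof.
move=> t0; rewrite -[_%:A]subr0; apply: norm_positive_sub; first exact: star0.
by rewrite cnorm0.
Qed.

Lemma norm_positiveD p q :
  norm_positive p -> norm_positive q -> norm_positive (p + q).
Proof.
move=> [sp [t ht]] [sq [s hs]]; split; first by rewrite starD sp sq.
exists (t + s); rewrite realAD opprD addrACA.
by apply: le_trans (cnormD_le _ _) _; apply: lerD.
Qed.

Lemma norm_positiveZ r p : 0 <= r -> norm_positive p ->
  norm_positive (r%:C *: p).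
Proof.
move=> r0 [sp [t ht]]; split; first by rewrite starZr sp.
exists (r * t); rewrite rmorphM /= -scalerA -scalerBr cnormZr ger0_norm//.
by rewrite ler_wpM2l.
Qed.

Lemma norm_positive_inv p t : norm_positive p -> 0 < t ->
  cinvertible (p + t%:C%:A).
Proof.
move=> [_ [s hs]] t0; rewrite (_ : p + _ = (s + t)%:C%:A - (s%:C%:A - p)).
  by apply: cinvertible_real_sub; apply: le_lt_trans hs _; rewrite ltrDl.
by rewrite realAD opprB addrACA -addrA addrCA [s%:C%:A + _]addrCA subrr addr0.
Qed.

(** If t is the norm of p and |t - p| > t, then neither sign of |t - p| can be a
    spectral value of t - p: one by hypothesis, the other by size. *)
Lemma inv_norm_positive p : star p = p ->
  (forall t, 0 < t -> cinvertible (p + t%:C%:A)) -> norm_positive p.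
Proof.
move=> sp inv; split=> //; exists (cnorm p).
set k := _ - p; set t := cnorm p; rewrite leNgt; apply/negP => tk.
have t0 : 0 <= t by exact: cnorm_ge0.
have sk : star k = k by rewrite starB star_real sp.
apply: (not_cinvertible_pm sk erefl (le_lt_trans t0 tk)).
  rewrite (_ : _ - k = p + (cnorm k - t)%:C%:A); first by apply: inv;
    rewrite subr_gt0.
  by rewrite realAB /k opprB addrCA.
rewrite (_ : _ + k = (cnorm k + t)%:C%:A - p).
  by apply: cinvertible_real_sub; rewrite ltrDr (le_lt_trans t0 tk).
by rewrite realAD -addrA.
Qed.

Lemma norm_positive_closed p : star p = p ->
  (forall t, 0 < t -> norm_positive (p + t%:C%:A)) -> norm_positive p.
Proof.
move=> sp hp; apply: inv_norm_positive => // t t0.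
have t2 : 0 < t / 2 by rewrite divr_gt0.
have := norm_positive_inv (hp _ t2) t2.
by rewrite -addrA -realAD -splitr.
Qed.

(** If h had larger norm than u, then |h| - h and |h| + h would both be
    invertible, being sums of the positive elements |u| - u, u - h or u + h and
    of a positive scalar. *)
Lemma cnorm_le_pm h u : star h = h -> star u = u ->
  norm_positive (u - h) -> norm_positive (u + h) -> cnorm h <= cnorm u.
Proof.
move=> sh su pm pp; rewrite leNgt; apply/negP => uh.
have d0 : 0 < cnorm h - cnorm u by rewrite subr_gt0.
have pu := norm_positive_sub su (lexx _).
apply: (not_cinvertible_pm sh erefl (le_lt_trans (cnorm_ge0 u) uh)).
  have := norm_positive_inv (norm_positiveD pu pm) d0.
  by rewrite addrA subrK realAB [_ - h + _]addrC addrA subrK.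
have := norm_positive_inv (norm_positiveD pu pp) d0.
by rewrite addrA subrK realAB [_ + h + _]addrC addrA subrK.
Qed.

Lemma cnorm_le_add p q : norm_positive p -> norm_positive q ->
  cnorm p <= cnorm (p + q).
Proof.
move=> pp pq; apply: cnorm_le_pm; first exact: pp.1.
- by rewrite starD pp.1 pq.1.
- by rewrite addrC addKr.
- by apply: norm_positiveD => //; apply: norm_positiveD.
Qed.

(** Write z = a + i b and l := h - a.  For real m, |l + i m|^2 <= |l|^2 + m^2,
    which is smaller than (b + m)^2 if b m is large; then
    h - z = (l + i m) - i (b + m) is invertible by a Neumann series. *)
Lemma cinvertible_nonreal h z : star h = h -> complex.Im z != 0 ->
  cinvertible (h - z%:A).
Proof.
case: z => a b /= sh b0; pose l := h - a%:C%:A.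
have sl : star l = l by rewrite starB star_real sh.
have hl : h = l + a%:C%:A by rewrite subrK.
clearbody l.
pose m : R := (cnorm l ^+ 2 + 1) / b.
pose w := l + (0 +i* m)%C%:A.
have sw : star w = l - (0 +i* m)%C%:A.
  rewrite starD sl star_scalar; congr (_ + _); rewrite -scaleNr; congr (_ *: _).
  by apply/eqP; rewrite eq_complex /= oppr0 !eqxx.
have nw : cnorm w ^+ 2 <= cnorm l ^+ 2 + m ^+ 2.
  rewrite -cnorm_star_mul sw.
  have -> : (l - (0 +i* m)%C%:A) * w = l * l + (m ^+ 2)%:C%:A.
    rewrite /w; set j := (0 +i* m)%C; rewrite mulrBl !mulrDr mulr_algr
      !mulr_algl.
    rewrite opprD addrA addrK scalerA.
    rewrite -scaleNr; congr (_ + _ *: _).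
    by apply/eqP; rewrite eq_complex /= !(mul0r, mulr0, addr0, sub0r, oppr0)
      opprK expr2 !eqxx.
  apply: le_trans (cnormD_le _ _) _; rewrite cnorm_scalar ger0_norm ?sqr_ge0//.
  by rewrite lerD2r -{1}sl cnorm_star_mul.
rewrite (_ : h - _ = - ((0 +i* (b + m))%C%:A - w)).
  apply/cinvertibleN/cinvertible_scalar_sub.
  rewrite Re_norm_imag -ltr_sqr ?nnegrE ?cnorm_ge0// real_normK ?num_real//.
  apply: le_lt_trans nw _.
  have mb : b * m = cnorm l ^+ 2 + 1 by rewrite /m mulrC divfK.
  have := sqr_ge0 b; have := sqr_ge0 (cnorm l); nra.
rewrite opprB /w hl -!addrA; congr (_ + _); rewrite -!scaleNr -!scalerDl.
by congr (_ *: _); apply/eqP; rewrite eq_complex /=; apply/andP; split;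
  apply/eqP; lra.
Qed.

Lemma cpositiveP p : cpositive p <-> norm_positive p.
Proof.
split=> [[sp hp]|pp].
  apply: inv_norm_positive => // t t0; apply: contrapT => ninv.
  have /hp : cspectrum p (- t)%:C.
    by move=> i; apply: ninv; move: i; rewrite rmorphN /= scaleNr opprK.
  by rewrite /= ler0c oppr_ge0 leNgt t0.
split; first exact: pp.1.
move=> z hz /=; rewrite lecE /=; have [iz|iz] := eqVneq (complex.Im z) 0;
  last first.
  by exfalso; apply: hz; apply: cinvertible_nonreal => //; exact: pp.1.
rewrite /= leNgt; apply/negP => rz; apply: hz.
have := @norm_positive_inv p (- complex.Re z) pp; rewrite oppr_gt0 => /(_ rz).
rewrite rmorphN /= scaleNr; congr cinvertible; congr (_ - _ *: _).
by case: z iz {rz} => a b /= ->.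
Qed.

End cstar_positive.

(** * Hilbert modules and their orthogonal sums *)

Section inner_algebra.
Variables (R : realType) (AA : cstarAlgType R) (E : innerModType AA).
Implicit Types (x y : E) (a : AA) (z w : R[i]).

Definition cscale z x : E := ((z%:A : AA) : AA^c) *: x.

Lemma inner0r x : inner x 0 = 0.
Proof. by rewrite -(scale0r (0 : E)) innerZr mulr0. Qed.

Lemma innerNr x y : inner x (- y) = - inner x y.
Proof. by apply/eqP; rewrite -subr_eq0 opprK -innerDr addNr inner0r. Qed.

Lemma innerNl x y : inner (- x) y = - inner x y.
Proof. by rewrite -star_inner innerNr starN star_inner. Qed.

Lemma innerBr x y y' : inner x (y - y') = inner x y - inner x y'.
Proof. by rewrite innerDr innerNr. Qed.

Lemma innerBl x x' y : inner (x - x') y = inner x y - inner x' y.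
Proof. by rewrite innerDl innerNl. Qed.

Lemma innerZl a x y : inner ((a : AA^c) *: x) y = star a * inner x y.
Proof. by rewrite -star_inner innerZr starM star_inner. Qed.

Lemma inner_cscaler z x y : inner x (cscale z y) = z *: inner x y.
Proof. by rewrite innerZr mulr_algr. Qed.

Lemma inner_cscalel z x y : inner (cscale z x) y = conjc z *: inner x y.
Proof. by rewrite innerZl star_scalar mulr_algl. Qed.

Lemma cscaleA z w x : cscale z (cscale w x) = cscale (z * w) x.
Proof.
rewrite /cscale scalerA; congr (_ *: _).
by rewrite /GRing.mul /= -scalerAl mul1r scalerA mulrC.
Qed.

Lemma cscale1 x : cscale 1 x = x.
Proof. by rewrite /cscale scale1r scale1r. Qed.

Lemma cscaleD z w x : cscale (z + w) x = cscale z x + cscale w x.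
Proof. by rewrite /cscale !scalerDl. Qed.

Lemma cscaleN z x : cscale (- z) x = - cscale z x.
Proof. by rewrite /cscale scaleNr scaleNr. Qed.

Lemma cscaleB z w x : cscale (z - w) x = cscale z x - cscale w x.
Proof. by rewrite cscaleD cscaleN. Qed.

Lemma cscaleDr z x y : cscale z (x + y) = cscale z x + cscale z y.
Proof. exact: scalerDr. Qed.

Lemma cscaleBr z x y : cscale z (x - y) = cscale z x - cscale z y.
Proof. exact: scalerBr. Qed.

End inner_algebra.

(** The best choice of t is b / X, or a large t if X = 0. *)
Lemma sqr_le_of_scaling (R : realType) (X Y b : R) :
  0 <= X -> 0 <= Y -> 0 <= b ->
  (forall t, 0 < t -> 2 * b <= t * X + t^-1 * Y) -> b ^+ 2 <= X * Y.
Proof.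
move=> X0 Y0 b0 h; have [->|bn] := eqVneq b 0; first by rewrite expr0n mulr_ge0.
have bp : 0 < b by rewrite lt0r bn.
have [Xe|Xn] := eqVneq X 0.
  have Y1 : 0 < Y + 1 by lra.
  have := h ((Y + 1) / b) (divr_gt0 Y1 bp); rewrite Xe mulr0 add0r invf_div.
  rewrite mulrAC ler_pdivlMr//; nra.
have Xp : 0 < X by rewrite lt0r Xn.
have := h (b / X) (divr_gt0 bp Xp); rewrite divfK// invf_div mulrAC.
rewrite -lerBlDl ler_pdivlMr// expr2; lra.
Qed.

Section hilbert_norm.
Variables (R : realType) (AA : cstarAlgType R) (E : hilbertModType AA).
Implicit Types (x y : E) (a : AA) (z w : R[i]).

Lemma norm_positive_inner x : norm_positive (inner x x).
Proof. exact/cpositiveP/inner_ge0. Qed.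

(** The sum of [inner x x] and [inner y y] dominates both signs of
    [inner x y + inner y x], with differences [inner (x - y) (x - y)] and
    [inner (x + y) (x + y)]. *)
Lemma cnorm_inner_symm x y :
  cnorm (inner x y + inner y x) <= cnorm (inner x x) + cnorm (inner y y).
Proof.
apply: le_trans (cnormD_le _ _); apply: cnorm_le_pm.
- by rewrite starD !star_inner addrC.
- by rewrite starD !star_inner.
- rewrite (_ : _ - _ = inner (x - y) (x - y)); first exact: norm_positive_inner.
  by rewrite innerBl !innerBr opprB opprD addrACA.
- rewrite (_ : _ + (_ + _) = inner (x + y) (x + y));
    first exact: norm_positive_inner.
  by rewrite innerDl !innerDr addrACA [inner y y + _]addrC.
Qed.

Lemma cauchy_schwarz_sa x y : star (inner x y) = inner x y ->
  cnorm (inner x y) ^+ 2 <= cnorm (inner x x) * cnorm (inner y y).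
Proof.
move=> sxy; apply: sqr_le_of_scaling; rewrite ?cnorm_ge0// => t t0.
pose s := Num.sqrt t.
have s0 : 0 < s by rewrite sqrtr_gt0.
have ss : s * s = t by rewrite -expr2 sqr_sqrtr// ltW.
have := cnorm_inner_symm (cscale s%:C x) (cscale s^-1%:C y).
rewrite !inner_cscaler !inner_cscalel !conjc_real !scalerA -!rmorphM /=.
rewrite mulfV ?gt_eqF// mulVf ?gt_eqF// !scale1r !cnormZr ss.
have -> : inner y x = inner x y by rewrite -[RHS]sxy star_inner.
by rewrite -invfM ss !gtr0_norm ?invr_gt0// cnorm_double.
Qed.

(** Replacing x by x b, where b is [inner x y], turns the inner product into the
    selfadjoint element b^* b, whose norm is |b|^2. *)
Lemma cauchy_schwarz x y :
  cnorm (inner x y) ^+ 2 <= cnorm (inner x x) * cnorm (inner y y).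
Proof.
set b := inner x y.
have ixb : inner ((b : AA^c) *: x) y = star b * b by rewrite innerZl.
have := @cauchy_schwarz_sa ((b : AA^c) *: x) y.
rewrite ixb starM starK => /(_ erefl); rewrite cnorm_star_mul.
have [->|bn] := eqVneq (cnorm b) 0; first by rewrite expr0n mulr_ge0 ?cnorm_ge0.
have bp : 0 < cnorm b ^+ 2 by rewrite exprn_gt0// lt0r bn cnorm_ge0.
move=> le; rewrite -(ler_pM2l bp) -expr2; apply: le_trans le _.
rewrite mulrA ler_wpM2r ?cnorm_ge0// innerZl innerZr.
apply: le_trans (cnormM_le _ _) _; rewrite cnorm_star expr2 -mulrA ler_wpM2l
  ?cnorm_ge0//.
by rewrite mulrC cnormM_le.
Qed.

Lemma hnorm_ge0 x : 0 <= hnorm x.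
Proof. exact: sqrtr_ge0. Qed.

Lemma hnorm_sqr x : hnorm x ^+ 2 = cnorm (inner x x).
Proof. by rewrite sqr_sqrtr// cnorm_ge0. Qed.

Lemma hnorm0 : hnorm (0 : E) = 0.
Proof. by rewrite /hnorm inner0r cnorm0 sqrtr0. Qed.

Lemma hnorm_eq0 x : hnorm x = 0 -> x = 0.
Proof.
by move=> h; apply/inner_eq0/cnorm_eq0; rewrite -hnorm_sqr h expr0n.
Qed.

Lemma inner_le_hnorm x y : cnorm (inner x y) <= hnorm x * hnorm y.
Proof.
rewrite -ler_sqr ?nnegrE ?mulr_ge0 ?hnorm_ge0 ?cnorm_ge0// exprMn !hnorm_sqr.
exact: cauchy_schwarz.
Qed.

Lemma hnormD_le x y : hnorm (x + y) <= hnorm x + hnorm y.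
Proof.
rewrite -ler_sqr ?nnegrE ?addr_ge0 ?hnorm_ge0// hnorm_sqr innerDl !innerDr
  sqrrD.
apply: le_trans (cnormD_le _ _) _.
apply: le_trans (lerD (cnormD_le _ _) (cnormD_le _ _)) _.
rewrite -!hnorm_sqr; have := inner_le_hnorm x y; have := inner_le_hnorm y x.
by rewrite mulrC => h1 h2; lra.
Qed.

Lemma hnorm_cscale z x : hnorm (cscale z x) = complex.Re `|z| * hnorm x.
Proof.
have n0 : 0 <= complex.Re `|z| by rewrite normc_def /= sqrtr_ge0.
apply/eqP; rewrite -(@eqrXn2 _ 2) ?mulr_ge0 ?hnorm_ge0//; apply/eqP.
rewrite hnorm_sqr inner_cscaler inner_cscalel !cnormZ normcJ exprMn hnorm_sqr.
by rewrite expr2 mulrA.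
Qed.

Lemma hnorm_real r x : hnorm (cscale r%:C x) = `|r| * hnorm x.
Proof. by rewrite hnorm_cscale Re_norm_real. Qed.

Lemma hnorm_opp x : hnorm (- x) = hnorm x.
Proof. by rewrite /hnorm innerNl innerNr opprK. Qed.

Lemma hnorm_complete : complete_norm (@hnorm R AA E).
Proof.
split; [exact: hnorm_ge0| |exact: hnormD_le|exact: hnorm_opp|exact: hcomplete].
by move=> x; split => [/hnorm_eq0//|->]; exact: hnorm0.
Qed.

Lemma inner_ext x x' : (forall y, inner x y = inner x' y) -> x = x'.
Proof.
move=> h; apply/eqP; rewrite -subr_eq0; apply/eqP/inner_eq0.
by rewrite innerBl h subrr.
Qed.

End hilbert_norm.

Section orthogonal_sum_hilbert.
Variables (R : realType) (AA : cstarAlgType R) (E1 E2 : hilbertModType AA).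
Implicit Types x y : (E1 * E2)%type.

Lemma sum_innerE x y : inner x y = inner x.1 y.1 + inner x.2 y.2.
Proof. by []. Qed.

Fact sum_inner_ge0 x : cpositive (inner x x).
Proof. by apply/cpositiveP/norm_positiveD; exact: norm_positive_inner. Qed.

Lemma hnorm_fst_le x : hnorm x.1 <= hnorm x.
Proof. by apply/ler_wsqrtr/cnorm_le_add; exact: norm_positive_inner. Qed.

Lemma hnorm_snd_le x : hnorm x.2 <= hnorm x.
Proof.
rewrite /hnorm sum_innerE addrC.
by apply/ler_wsqrtr/cnorm_le_add; exact: norm_positive_inner.
Qed.

Lemma hnorm_pair_le x : hnorm x <= hnorm x.1 + hnorm x.2.
Proof.
rewrite -ler_sqr ?nnegrE ?addr_ge0 ?sqrtr_ge0// sqr_sqrtr ?cnorm_ge0//.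
apply: le_trans (cnormD_le _ _) _; rewrite -!hnorm_sqr sqrrD.
by have := mulr_ge0 (hnorm_ge0 x.1) (hnorm_ge0 x.2); lra.
Qed.

Fact sum_inner_eq0 x : inner x x = 0 -> x = 0.
Proof.
move=> h; have h0 : hnorm x = 0 by rewrite /hnorm h cnorm0 sqrtr0.
case: x h h0 => x1 x2 _ h0; congr pair; apply: hnorm_eq0; apply/eqP;
  rewrite eq_le hnorm_ge0 andbT -h0;
    [exact: (hnorm_fst_le (x1, x2))|exact: (hnorm_snd_le (x1, x2))].
Qed.

Fact sum_hcomplete (u : nat -> (E1 * E2)%type) :
  (forall e : R, 0 < e -> exists N, forall m n,
     (N <= m)%N -> (N <= n)%N -> hnorm (u m - u n) < e) ->
  exists l, forall e : R, 0 < e -> exists N, forall n,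
     (N <= n)%N -> hnorm (u n - l) < e.
Proof.
move=> hu.
have [l1 h1] : exists l, forall e : R, 0 < e -> exists N, forall n,
     (N <= n)%N -> hnorm ((u n).1 - l) < e.
  apply: hcomplete => e /hu[N hN]; exists N => m n mN nN.
  by apply: le_lt_trans (hnorm_fst_le (u m - u n)) (hN _ _ mN nN).
have [l2 h2] : exists l, forall e : R, 0 < e -> exists N, forall n,
     (N <= n)%N -> hnorm ((u n).2 - l) < e.
  apply: hcomplete => e /hu[N hN]; exists N => m n mN nN.
  by apply: le_lt_trans (hnorm_snd_le (u m - u n)) (hN _ _ mN nN).
exists (l1, l2) => e e0; have e2 : 0 < e / 2 by rewrite divr_gt0.
have [N1 hN1] := h1 _ e2; have [N2 hN2] := h2 _ e2.
exists (maxn N1 N2) => n; rewrite geq_max => /andP[n1 n2].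
apply: le_lt_trans (hnorm_pair_le _) _; rewrite [e]splitr.
by apply: ltrD; [exact: hN1|exact: hN2].
Qed.

HB.instance Definition _ := isHilbertModule.Build R AA (E1 * E2)%type
  sum_inner_ge0 sum_inner_eq0 sum_hcomplete.

End orthogonal_sum_hilbert.

(** * Adjointable and symmetric operators *)

Section adjointable_operators.
Variables (R : realType) (AA : cstarAlgType R).
Implicit Types E F : hilbertModType AA.

Lemma adj_sub E F (T : adjointable E F) : {morph T : x y / x - y}.
Proof.
by move=> x y; apply: inner_ext => z; rewrite innerBl !adjP innerBl.
Qed.

Lemma adj0 E F (T : adjointable E F) : T 0 = 0.
Proof. by have := adj_sub T 0 0; rewrite !subrr. Qed.

Lemma adj_cscale E F (T : adjointable E F) z x :
  T (cscale z x) = cscale z (T x).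
Proof.
by apply: inner_ext => y; rewrite adjP !inner_cscalel adjP.
Qed.

(** Uniform boundedness by a gliding hump.  If T is unbounded, choose [xs n]
    with |T (xs n)| > 4^n |xs n|.  The functional [f n], pairing with
    T (xs n), is bounded at each fixed y by |xs n| |T^* y|.  Adding or
    subtracting at step n a multiple of T (xs n) of norm 3^-n produces a limit
    l at which [f n] is at least 3^-n |T (xs n)| / 2 for every n, which is too
    large. *)
Lemma adjointable_bounded E F (T : adjointable E F) :
  exists2 M : R, 0 <= M & forall x, hnorm (T x) <= M * hnorm x.
Proof.
apply: contrapT => unb.
have /choice[xs hxs] : forall n : nat, exists x, 4 ^+ n * hnorm x < hnorm (T x).
  move=> n; apply: contrapT => h; apply: unb; exists (4 ^+ n);
    first exact: exprn_ge0.
  by move=> x; rewrite leNgt; apply/negP => lt; apply: h; exists x.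
have Tx0 n : 0 < hnorm (T (xs n)).
  by apply: le_lt_trans (hxs n); rewrite mulr_ge0 ?exprn_ge0 ?hnorm_ge0.
have x0 n : 0 < hnorm (xs n).
  rewrite lt0r hnorm_ge0 andbT; apply/eqP => /hnorm_eq0 xe.
  by have := Tx0 n; rewrite xe adj0 hnorm0 ltxx.
pose f n (y : F) := cnorm (inner (T (xs n)) y).
pose v n : F := cscale (3^-1 ^+ n / hnorm (T (xs n)))%:C (T (xs n)).
have hv n : hnorm (v n) = 3^-1 ^+ n.
  rewrite hnorm_real ger0_norm ?mulr_ge0 ?exprn_ge0 ?invr_ge0 ?hnorm_ge0//.
  by rewrite divfK// gt_eqF.
have fv n : f n (v n) = 3^-1 ^+ n * hnorm (T (xs n)).
  rewrite /f /v inner_cscaler cnormZr -hnorm_sqr.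
  rewrite ger0_norm ?mulr_ge0 ?exprn_ge0 ?invr_ge0 ?hnorm_ge0//.
  by rewrite expr2 mulrA divfK// gt_eqF.
(* One of the two signs gives a value of f n that is at least f n (v n),
   because the two points differ by twice v n. *)
pose step n y := if f n (v n) <= f n (y + v n) then y + v n else y - v n.
pose ys := fix ys n : F := if n is n'.+1 then step n' (ys n') else 0.
have hys n : f n (v n) <= f n (ys n.+1).
  rewrite /= /step; case: ifPn => //; rewrite -ltNge => lt.
  have e : inner (T (xs n)) (v n) + inner (T (xs n)) (v n)
      = inner (T (xs n)) (ys n + v n) - inner (T (xs n)) (ys n - v n).
    by rewrite innerDr innerBr opprB addrAC addrCA subrr addr0 addrC.
  have := cnormD_le (inner (T (xs n)) (ys n + v n))
    (- inner (T (xs n)) (ys n - v n)).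
  by rewrite -e cnorm_double cnormN -/(f _ _) -/(f _ _) -/(f _ _); lra.
have [||n|l hl] := geometric_limit (hnorm_complete F) (u := ys) (C := 1)
  (r := 3^-1).
- by rewrite invr_ge0.
- by lra.
- by rewrite mul1r -hv /= /step; case: ifP => _;
    rewrite addrAC subrr add0r ?hnorm_opp.
have key n : 4 ^+ n < 2 * hnorm (adj_adj T l) * 3 ^+ n.
  have up : f n l <= hnorm (xs n) * hnorm (adj_adj T l).
    by rewrite /f adjP; exact: inner_le_hnorm.
  (* The later steps move by at most 3^-(n+1) (1 + 1/3 + ...) = 3^-n / 2. *)
  have d : f n (ys n.+1 - l) <= hnorm (T (xs n)) * (2^-1 * 3^-1 ^+ n).
    apply: le_trans (inner_le_hnorm _ _) _; rewrite ler_wpM2l ?hnorm_ge0//.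
    apply: le_trans (hl _) _; rewrite exprS mulrA ler_wpM2r ?exprn_ge0
      ?invr_ge0//.
    by rewrite (_ : 1 - 3^-1 = 2 / 3 :> R) ?invf_div; lra.
  have tr : f n (ys n.+1) <= f n (ys n.+1 - l) + f n l.
    by rewrite /f -{1}(subrK l (ys n.+1)) innerDr cnormD_le.
  have := hys n; rewrite fv => lo; have := hxs n; have := x0 n.
  have t3 : 3^-1 ^+ n * 3 ^+ n = 1 :> R
    by rewrite -exprMn mulVf ?expr1n ?pnatr_eq0.
  have t0 : 0 < 3 ^+ n :> R by rewrite exprn_gt0.
  move: lo d tr up; set X := hnorm (xs n); set Y := hnorm (T (xs n)).
  set L := hnorm (adj_adj T l); set q := 3^-1 ^+ n; set p := 3 ^+ n.
  move=> lo d tr up X0 XY; rewrite -(ltr_pM2r X0); apply: lt_le_trans XY _.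
  have : 2^-1 * (q * Y) <= X * L by lra.
  rewrite -(ler_pM2l t0) -/p => h; have -> : Y = p * (q * Y).
    by rewrite mulrA (mulrC p) t3 mul1r.
  by lra.
have r0 : 0 <= 3 / 4 :> R by lra.
have r1 : 3 / 4 < 1 :> R by lra.
have [N hN] := geom_lt_eps (2 * hnorm (adj_adj T l)) r0 r1 ltr01.
have := hN N (leqnn _); have := key N.
rewrite expr_div_n mulrA ltr_pdivrMr ?exprn_gt0// mul1r => h1 h2.
by have := lt_trans h1 h2; rewrite ltxx.
Qed.

(** A right inverse of the adjoint is an adjoint of a right inverse. *)
Lemma surjective_invertible E (T : adjointable E E) :
  (forall v, exists w, T w = v) -> (forall v, exists w, adj_adj T w = v) ->
  invertible_op T.
Proof.
move=> /choice[S hS] /choice[S' hS'].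
have SS' x y : inner (S x) y = inner x (S' y).
  by rewrite -{1}(hS' y) -adjP hS.
exists (Adjointable SS'); split=> x /=; last exact: hS.
by apply: inner_ext => y; rewrite SS' adjP hS'.
Qed.

Lemma invertible_op_ext E (T T' : adjointable E E) :
  T =1 T' -> invertible_op T -> invertible_op T'.
Proof.
by move=> e [S [h1 h2]]; exists S; split=> x; rewrite -e ?h1 ?h2.
Qed.

Lemma invertible_bounded_below E (T : adjointable E E) : invertible_op T ->
  exists2 C : R, 0 <= C & forall x, hnorm x <= C * hnorm (T x).
Proof.
move=> [S [h1 _]]; have [C C0 hC] := adjointable_bounded S.
by exists C => // x; have := hC (T x); rewrite h1.
Qed.

End adjointable_operators.

Section symmetric_operators.
Variables (R : realType) (AA : cstarAlgType R) (E : hilbertModType AA).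
Implicit Types (x y : E) (k K : E -> E).

Definition symmetric_fun k := forall x y, inner (k x) y = inner x (k y).

Lemma symmetric_sub k : symmetric_fun k -> {morph k : x y / x - y}.
Proof. by move=> sk x y; exact: (adj_sub (Adjointable sk)). Qed.

Lemma symmetric_add k : symmetric_fun k -> {morph k : x y / x + y}.
Proof.
by move=> sk x y; apply: inner_ext => z; rewrite innerDl !sk innerDl.
Qed.

Lemma symmetric_iter k n : symmetric_fun k -> symmetric_fun (iter n k).
Proof.
move=> sk; elim: n => [|n IH] x y //=.
by rewrite sk IH -iterS iterSr.
Qed.

Lemma symmetric_real_sub k r : symmetric_fun k ->
  symmetric_fun (fun x => cscale r%:C x - k x).
Proof.
by move=> sk x y; rewrite innerBl innerBr inner_cscalel inner_cscaler conjc_real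
  sk.
Qed.

Lemma symmetric_real_scale k r : symmetric_fun k ->
  symmetric_fun (fun x => cscale r%:C (k x)).
Proof.
by move=> sk x y; rewrite inner_cscalel inner_cscaler conjc_real sk.
Qed.

(** The vector form of [cnorm_double_le]: the inner square of x + k^2 x is that
    of x - k^2 x plus four times that of k x. *)
Lemma hnorm_double_le k x : symmetric_fun k ->
  2 * hnorm (k x) <= hnorm (x + k (k x)).
Proof.
move=> sk; rewrite -ler_sqr ?nnegrE ?mulr_ge0 ?hnorm_ge0// exprMn !hnorm_sqr.
have -> : inner (x + k (k x)) (x + k (k x)) =
    4%:C *: inner (k x) (k x) + inner (x - k (k x)) (x - k (k x)).
  have q1 : inner (k (k x)) x = inner (k x) (k x) by rewrite sk.
  have q2 : inner x (k (k x)) = inner (k x) (k x) by rewrite -sk.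
  rewrite innerDl innerBl !innerDr !innerNr q1 q2.
  set a := inner x x; set q := inner (k x) (k x); set b := inner (k (k x)) _.
  have -> : (4 : R)%:C *: q = (q + q) + (q + q).
    by rewrite (_ : (4 : R) = 1 + 1 + (1 + 1)) ?rmorphD ?rmorph1 ?scalerDl
      ?scale1r //; lra.
  rewrite opprB [a - q + _]addrACA -opprD [q + b]addrC [LHS]addrACA.
  by set X := q + q; rewrite [RHS]addrC [RHS]addrA subrK.
have p : norm_positive (4%:C *: inner (k x) (k x)).
  by apply: norm_positiveZ => //; exact: norm_positive_inner.
have := cnorm_le_add p (norm_positive_inner (x - k (k x))).
rewrite cnormZr ger0_norm//; apply: le_trans.
by rewrite (_ : 2 ^+ 2 = 4 :> R)//; lra.
Qed.

Lemma hnorm_telescope k n v : symmetric_fun k ->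
  forall w, w = iter (2 ^ n).-1 k v ->
  2 ^+ n * hnorm (w - k (k w)) <= hnorm (v - iter (2 ^ n.+1) k v).
Proof.
move=> sk; elim: n v => [|n IH] v w wE.
  by rewrite wE expr0 mul1r; exact: lexx.
pose K := iter (2 ^ n) k; have sK : symmetric_fun K by exact: symmetric_iter.
have KK x : K (K x) = iter (2 ^ n.+1) k x.
  by rewrite /K -iterD addnn -mul2n -expnS.
have := hnorm_double_le (v - iter (2 ^ n.+1) k v) sK.
rewrite KK (symmetric_sub (symmetric_iter _ sk)) -iterD addnn -mul2n -expnS.
rewrite addrA subrK; apply: le_trans.
rewrite (symmetric_sub sK) -!KK (KK (K v)).
rewrite exprS -mulrA ler_pM2l//; apply: (IH (K v)); rewrite wE /K -iterD;
  congr iter.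
by have := expn_gt0 2 n; rewrite expnS; lia.
Qed.

Lemma symmetric_sqrt_bound k e : symmetric_fun k -> 0 <= e ->
  (forall x, hnorm (k (k x)) <= e * hnorm x) ->
  forall x, hnorm (k x) <= Num.sqrt e * hnorm x.
Proof.
move=> sk e0 h x.
rewrite -ler_sqr ?nnegrE ?mulr_ge0 ?sqrtr_ge0 ?hnorm_ge0// exprMn
  (sqr_sqrtr e0).
rewrite (hnorm_sqr (k x)) -sk; apply: le_trans (inner_le_hnorm _ _) _.
by rewrite [hnorm x ^+ 2]expr2 mulrA ler_wpM2r ?hnorm_ge0.
Qed.

(** The operator form of [not_cinvertible_sqr]: if 1 - k^2 is bounded below,
    [hnorm_telescope] makes some k^(2^n) a strict contraction, and by
    [symmetric_sqrt_bound] this descends to k itself. *)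
Lemma symmetric_strict_contraction k C : symmetric_fun k -> 0 <= C ->
  (forall x, hnorm (k x) <= hnorm x) ->
  (forall x, hnorm x <= C * hnorm (x - k (k x))) ->
  exists e, [/\ 0 <= e, e < 1 & forall x, hnorm (k x) <= e * hnorm x].
Proof.
move=> sk C0 k1 kC.
have kn n x : hnorm (iter n k x) <= hnorm x.
  by elim: n => //= n; apply: le_trans (k1 _).
have pow n : exists2 e, 0 <= e & e = 2 * C / 2 ^+ n /\
    forall x, hnorm (iter (2 ^ n) k x) <= e * hnorm x.
  exists (2 * C / 2 ^+ n); first by rewrite divr_ge0 ?mulr_ge0 ?exprn_ge0.
  split=> // x; rewrite mulrAC ler_pdivlMr ?exprn_gt0// mulrC.
  have e2 : (2 ^ n = (2 ^ n).-1.+1)%N by rewrite prednK// expn_gt0.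
  rewrite e2 iterSr.
  set w := iter _ k (k x).
  have t := hnorm_telescope sk (erefl w).
  have n0 : 0 < 2 ^+ n :> R by rewrite exprn_gt0.
  apply: le_trans (_ : 2 ^+ n * (C * hnorm (w - k (k w))) <= _).
    by rewrite ler_wpM2l// ltW.
  rewrite mulrCA [2 * C]mulrC -mulrA ler_wpM2l//; apply: le_trans t _.
  apply: le_trans (hnormD_le _ _) _; rewrite hnorm_opp.
  by have := kn (2 ^ n.+1)%N (k x); have := k1 x; lra.
pose n := Num.bound (2 * C).
have [e e0 [eE he]] := pow n.
have e1 : e < 1.
  by rewrite eE ltr_pdivrMr ?exprn_gt0// mul1r; exact: upper_nthrootP.
move: (n) e e0 e1 he {pow eE} => m; elim: m => [|m IH] e e0 e1 he;
  first by exists e.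
apply: (IH (Num.sqrt e)); first exact: sqrtr_ge0.
  by rewrite -sqrtr1 ltr_sqrt.
apply: symmetric_sqrt_bound => //; first exact: symmetric_iter.
by move=> x; rewrite -iterD addnn -mul2n -expnS.
Qed.

Lemma optimal_bound k M : 0 <= M -> (forall x, hnorm (k x) <= M * hnorm x) ->
  exists n, [/\ 0 <= n, forall x, hnorm (k x) <= n * hnorm x &
    forall m, 0 <= m -> (forall x, hnorm (k x) <= m * hnorm x) -> n <= m].
Proof.
move=> M0 hM; pose S :=
  [set m : R | 0 <= m /\ forall x, hnorm (k x) <= m * hnorm x].
have SM : S M by [].
have lb : lbound S 0 by move=> m [].
have hinf : has_inf S by split; [exists M|exists 0].
exists (inf S); split.
- by apply: lb_le_inf; [exists M|].
- move=> x; have [xe|xn] := eqVneq (hnorm x) 0.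
    by have := hM x; rewrite xe !mulr0.
  have xp : 0 < hnorm x by rewrite lt0r xn hnorm_ge0.
  rewrite -ler_pdivrMr//; apply: lb_le_inf; first by exists M.
  by move=> m [_ hm]; rewrite ler_pdivrMr.
- by move=> m m0 hm; apply: ge_inf; [exists 0|].
Qed.

(** By 1 - K = (1 - K)^2 / 2 + (1 - K^2) / 2, and K^2 is again a symmetric
    contraction; after n steps the remainder has norm at most
    2 |x|^2 / 2^n. *)
Lemma contraction_form_positive K x : symmetric_fun K ->
  (forall y, hnorm (K y) <= hnorm y) -> norm_positive (inner (x - K x) x).
Proof.
have saK L : symmetric_fun L -> star (inner (x - L x) x) = inner (x - L x) x.
  by move=> sL; rewrite star_inner innerBl innerBr sL.
have step n L : symmetric_fun L -> (forall y, hnorm (L y) <= hnorm y) ->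
    norm_positive (inner (x - L x) x + (2 * hnorm x ^+ 2 * 2^-1 ^+ n)%:C%:A).
  elim: n L => [|n IH] L sL hL.
    rewrite expr0 mulr1 addrC -[inner _ _]opprK; apply: norm_positive_sub.
      by rewrite starN saK.
    rewrite cnormN; apply: le_trans (inner_le_hnorm _ _) _; rewrite expr2 mulrA.
    rewrite ler_wpM2r ?hnorm_ge0//; apply: le_trans (hnormD_le _ _) _;
      rewrite hnorm_opp.
    by have := hL x; lra.
  have h0 : 0 <= 2^-1 :> R by lra.
  have sLL : symmetric_fun (fun y => L (L y)) by move=> y y'; rewrite !sL.
  have hLL y : hnorm (L (L y)) <= hnorm y by apply: le_trans (hL _).
  have := norm_positiveD (norm_positiveZ h0 (norm_positive_inner (x - L x)))
    (norm_positiveZ h0 (IH _ sLL hLL)).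
  congr norm_positive; rewrite scalerDr scalerA -rmorphM /= mulrCA -exprS addrA.
  congr (_ + _); rewrite -scalerDr innerBl !innerBr !innerBl !sL opprB -addrA.
  rewrite [inner x (L (L x)) - _ + _]addrC [_ - inner x (L (L x)) + _]addrA
    subrK scalerDr -scalerDl -rmorphD.
  by rewrite /= (_ : 2^-1 + 2^-1 = 1 :> R) ?scale1r//; lra.
move=> sK hK; apply: norm_positive_closed; first exact: saK.
move=> t t0.
have h0 : 0 <= 2^-1 :> R by lra.
have h1 : 2^-1 < 1 :> R by lra.
have [N hN] := geom_lt_eps (2 * hnorm x ^+ 2) h0 h1 t0.
have d0 := ltW (hN N (leqnn _)); rewrite -subr_ge0 in d0.
have := norm_positiveD (step N K sK hK) (norm_positive_real AA d0).
by rewrite -addrA -realAD (addrC _ (t - _)) subrK.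
Qed.

(** The argument of [cinvertible_nonreal], for the norm of vectors. *)
Lemma symmetric_nonreal_surjective k z v : symmetric_fun k ->
  complex.Im z != 0 ->
  exists w, k w - cscale z w = v.
Proof.
case: z => a b /= sk b0; pose L x := k x - cscale a%:C x.
have sL : symmetric_fun L.
  by move=> x y; rewrite innerBl innerBr inner_cscalel inner_cscaler conjc_real
    sk.
have hL x : L x = k x - cscale a%:C x by [].
clearbody L; have [M M0 hM] := adjointable_bounded (Adjointable sL).
pose m : R := (M ^+ 2 + 1) / b; pose z := (0 +i* (b + m))%C.
pose W x := L x + cscale (0 +i* m)%C x.
have hW x : hnorm (W x) ^+ 2 <= (M ^+ 2 + m ^+ 2) * hnorm x ^+ 2.
  have -> : hnorm (W x) ^+ 2 =
    cnorm (inner (L x) (L x) + (m ^+ 2)%:C *: inner x x).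
    rewrite hnorm_sqr /W innerDl !innerDr !inner_cscalel !inner_cscaler
      -(sL x x).
    have -> : (0 +i* m)^*%C = - (0 +i* m)%C.
      by apply/eqP; rewrite eq_complex /= oppr0 !eqxx.
    rewrite scaleNr addrA addrK scalerA; congr (cnorm (_ + _ *: _)).
    apply/eqP; rewrite eq_complex /= !(mul0r, mulr0, addr0, sub0r, oppr0).
    by rewrite mulNr opprK expr2 !eqxx.
  apply: le_trans (cnormD_le _ _) _; rewrite cnormZr ger0_norm ?sqr_ge0//.
  rewrite -!hnorm_sqr mulrDl lerD2r -exprMn.
  by rewrite ler_sqr ?nnegrE ?mulr_ge0 ?hnorm_ge0//; exact: hM.
have mb : b * m = M ^+ 2 + 1 by rewrite /m mulrC divfK.
have bm0 : b + m != 0.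
  by apply/eqP => e; have := sqr_ge0 M; have := sqr_ge0 b; nra.
have z0 : z != 0 by rewrite eq_complex /= negb_and bm0 orbT.
have nz : complex.Re `|z^-1| = `|b + m|^-1 by rewrite Re_normV Re_norm_imag.
have s0 : 0 <= M ^+ 2 + m ^+ 2 by rewrite addr_ge0 ?sqr_ge0.
pose r := Num.sqrt (M ^+ 2 + m ^+ 2) / `|b + m|.
have r0 : 0 <= r by rewrite divr_ge0 ?sqrtr_ge0.
have r1 : r < 1.
  rewrite ltr_pdivrMr ?normr_gt0// mul1r -sqrtr_sqr ltr_sqrt ?exprn_even_gt0//.
  by have := sqr_ge0 b; have := sqr_ge0 M; nra.
have [|x|w hw] := @neumann_contraction R E (@hnorm R AA E) (hnorm_complete E)
    (fun x => cscale z^-1 (W x)) r (cscale (- z^-1) v) _ _ r0 r1.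
- move=> x y; rewrite -cscaleBr; congr (cscale _ _).
  by rewrite /W (symmetric_sub sL) cscaleBr opprD addrACA.
- rewrite hnorm_cscale nz /r mulrC mulrAC ler_wpM2r ?invr_ge0//.
  rewrite -ler_sqr ?nnegrE ?mulr_ge0 ?sqrtr_ge0 ?hnorm_ge0//.
  by rewrite exprMn (sqr_sqrtr s0) hW.
exists w; have := congr1 (fun u => - cscale z u) hw.
rewrite cscaleBr !cscaleA mulrN mulfV// cscaleN !cscale1 opprK opprB => <-.
rewrite /W hL -!addrA -!cscaleN -!cscaleD; congr (_ + cscale _ _).
by apply/eqP; rewrite eq_complex /=; apply/andP; split; apply/eqP; lra.
Qed.

End symmetric_operators.

(** * Positive operators and the Schur complement *)

Section positive_operators.
Variables (R : realType) (AA : cstarAlgType R) (E : hilbertModType AA).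
Implicit Types (T : adjointable E E) (x y : E).

Lemma symmetric_cscale (k : E -> E) z x :
  symmetric_fun k -> k (cscale z x) = cscale z (k x).
Proof. by move=> sk; exact: (adj_cscale (Adjointable sk)). Qed.

Lemma selfadjoint_symmetric T : selfadjoint T -> symmetric_fun T.
Proof. by move=> sT x y; rewrite adjP (sT y). Qed.

Lemma positive_op_shift_invertible T t : positive_op T -> 0 < t ->
  invertible_op (sub_op T (scalar_op E (- t)%:C)).
Proof.
move=> [_ sp] t0; apply: contrapT => ninv.
have : spectrum T (- t)%:C by [].
by move=> /sp; rewrite /= ler0c oppr_ge0 leNgt t0.
Qed.

(** If the best bound n of K := t - T exceeded t, both n - K = T + (n - t) and
    n + K = (n + t) - T would be bounded below, hence so would 1 - (K / n)^2,
    and [symmetric_strict_contraction] would improve the bound n. *)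
Lemma positive_op_contraction T : positive_op T ->
  exists2 t : R, 0 < t & forall x, hnorm (cscale t%:C x - T x) <= t * hnorm x.
Proof.
move=> pT; have sT := selfadjoint_symmetric pT.1.
have [M M0 hM] := adjointable_bounded T.
pose t := M + 1; have t0 : 0 < t by rewrite ltr_wpDl.
exists t => // x; pose K y := cscale t%:C y - T y; rewrite -/(K x).
have sK : symmetric_fun K by exact: symmetric_real_sub.
have KE y : K y = cscale t%:C y - T y by [].
clearbody K.
have [N N0 hN] := adjointable_bounded (Adjointable sK).
have [n [n0 hn opt]] := optimal_bound N0 hN.
apply: le_trans (hn x) _; rewrite ler_wpM2r ?hnorm_ge0// leNgt;
  apply/negP => tn.
have np : 0 < n by exact: lt_trans tn.
have [C C0 hC] : exists2 C : R, 0 <= C &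
    forall y, hnorm y <= C * hnorm (cscale n%:C y - K y).
  have [|C C0 hC] := invertible_bounded_below
    (positive_op_shift_invertible (t := n - t) pT _).
    by rewrite subr_gt0.
  exists C => // y; apply: le_trans (hC y) _; rewrite ler_wpM2l// le_eqVlt.
  apply/orP; left; apply/eqP; congr hnorm => /=.
  rewrite -/(cscale _ y) KE rmorphN /= cscaleN opprK rmorphB /= cscaleB opprB.
  by rewrite addrCA addrA.
have lower y : n * hnorm y <= hnorm (cscale n%:C y + K y).
  rewrite KE addrA -cscaleD -rmorphD /=.
  have := hnormD_le (cscale (n + t)%:C y - T y) (T y).
  rewrite subrK hnorm_real ger0_norm ?addr_ge0 ?(ltW t0)//.
  by have := hM y; have := hnorm_ge0 y; rewrite /t; nra.
pose k y := cscale n^-1%:C (K y).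
have sk : symmetric_fun k by exact: symmetric_real_scale.
have nK y : cscale n%:C (k y) = K y.
  by rewrite cscaleA -rmorphM /= mulfV ?cscale1// gt_eqF.
have k1 y : hnorm (k y) <= hnorm y.
  by rewrite hnorm_real gtr0_norm ?invr_gt0// mulrC ler_pdivrMr// mulrC.
have kC y : hnorm y <= C * n * hnorm (y - k (k y)).
  rewrite -(ler_pM2l np); apply: le_trans (lower y) _.
  apply: le_trans (hC _) _; rewrite mulrCA -mulrA ler_wpM2l// mulrA.
  have -> : cscale n%:C (cscale n%:C y + K y) - K (cscale n%:C y + K y)
      = cscale (n * n)%:C (y - k (k y)).
    rewrite (symmetric_add sK) (symmetric_cscale _ _ sK) cscaleDr opprD addrA
      addrK.
    by rewrite rmorphM -[RHS]cscaleA !cscaleBr nK -(symmetric_cscale _ _ sK) nK.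
  by rewrite hnorm_real ger0_norm// mulr_ge0// ltW.
have [|e [e0 e1 he]] := symmetric_strict_contraction sk _ k1 kC.
  by rewrite mulr_ge0.
have : n <= n * e.
  apply: opt; first by rewrite mulr_ge0.
  by move=> y; rewrite /= -nK hnorm_real ger0_norm// -mulrA ler_wpM2l.
by rewrite -{1}[n]mulr1 ler_pM2l// leNgt e1.
Qed.

(** With t as in [positive_op_contraction], T = t (1 - K) for the contraction
    K := 1 - T / t. *)
Lemma positive_op_form T x : positive_op T -> norm_positive (inner (T x) x).
Proof.
move=> pT; have sT := selfadjoint_symmetric pT.1.
have [t t0 ht] := positive_op_contraction pT.
pose K y := cscale t^-1%:C (cscale t%:C y - T y).
have sK : symmetric_fun K by apply/symmetric_real_scale/symmetric_real_sub.
have K1 y : hnorm (K y) <= hnorm y.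
  rewrite hnorm_real gtr0_norm ?invr_gt0// mulrC ler_pdivrMr// mulrC; exact: ht.
have tV : t * t^-1 = 1 by rewrite mulfV ?gt_eqF.
have := norm_positiveZ (ltW t0) (contraction_form_positive x sK K1).
have -> : x - K x = cscale t^-1%:C (T x).
  by rewrite /K cscaleBr cscaleA -rmorphM /= mulrC tV cscale1 opprB addrCA subrr
    addr0.
by rewrite inner_cscalel conjc_real scalerA -rmorphM /= tV scale1r.
Qed.

Section shift.
Variables (T : adjointable E E) (a l : R).
Hypotheses (T_ge : op_ge T (scalar_op E a%:C)) (la : l < a).
Let P := sub_op T (scalar_op E l%:C).

Lemma shift_form x : inner (P x) x =
  inner (sub_op T (scalar_op E a%:C) x) x + (a - l)%:C *: inner x x.
Proof.
have -> : P x = sub_op T (scalar_op E a%:C) x + cscale (a - l)%:C x.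
  by rewrite rmorphB cscaleB /= addrA subrK.
by rewrite innerDl inner_cscalel conjc_real.
Qed.

Lemma shift_lower x : (a - l) * hnorm x ^+ 2 <= cnorm (inner (P x) x).
Proof.
have d0 : 0 <= a - l by rewrite subr_ge0 ltW.
rewrite hnorm_sqr shift_form (addrC (inner (_ x) x)) -{1}(ger0_norm d0)
  -cnormZr.
apply: cnorm_le_add; last exact: positive_op_form.
by apply: norm_positiveZ => //; exact: norm_positive_inner.
Qed.

Lemma shift_invertible : invertible_op P.
Proof.
have d0 : 0 < a - l by rewrite subr_gt0.
apply: invertible_op_ext (positive_op_shift_invertible T_ge d0) => x /=.
rewrite -!/(cscale _ x) rmorphN /= cscaleN opprK rmorphB /= cscaleB addrA.
by rewrite subrK.
Qed.

(** For l >= 0, kappa = a / (a - l) works since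
    a (T - l) - (a - l) T = l (T - a), and s kappa < 1 because
    l < a (1 - s)^2 <= a (1 - s).  For l < 0, T - l dominates T. *)
Lemma shift_upper s : 0 < a -> 0 <= s -> s < 1 -> l < a * (1 - s) ^+ 2 ->
  exists kappa, [/\ 0 <= kappa, s * kappa < 1 &
    forall x, cnorm (inner (T x) x) <= kappa * cnorm (inner (P x) x)].
Proof.
move=> a0 s0 s1 ls.
have TE x : inner (T x) x =
    inner (sub_op T (scalar_op E a%:C) x) x + a%:C *: inner x x.
  have -> : T x = sub_op T (scalar_op E a%:C) x + cscale a%:C x
    by rewrite /= subrK.
  by rewrite innerDl inner_cscalel conjc_real.
have [l0|l0] := ltP l 0.
  exists 1; rewrite mulr1; split=> // x; rewrite mul1r.
  have -> : inner (P x) x = inner (T x) x + (- l)%:C *: inner x x.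
    by rewrite shift_form TE -addrA -scalerDl -rmorphD.
  have pp := norm_positive_inner x.
  apply: cnorm_le_add; last by apply: norm_positiveZ => //;
    rewrite oppr_ge0 ltW.
  rewrite TE; apply: norm_positiveD; first exact: positive_op_form.
  by apply: norm_positiveZ => //; rewrite ltW.
have d0 : 0 < a - l by rewrite subr_gt0.
exists (a / (a - l)); split; first by rewrite divr_ge0 ?ltW.
  rewrite mulrA ltr_pdivrMr// mul1r.
  have : (1 - s) ^+ 2 <= 1 - s by rewrite expr2 ger_pMl; lra.
  by nra.
move=> x; rewrite mulrAC ler_pdivlMr// mulrC.
rewrite -(gtr0_norm d0) -[X in _ <= X * _](gtr0_norm a0) -!cnormZr.
have -> : a%:C *: inner (P x) x = (a - l)%:C *: inner (T x) x +
    l%:C *: inner (sub_op T (scalar_op E a%:C) x) x.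
  rewrite shift_form TE !scalerDr !scalerA [a%:C * _]mulrC addrAC -scalerDl
    -rmorphD.
  by rewrite subrK.
apply: cnorm_le_add; last first.
  by apply: norm_positiveZ => //; exact: positive_op_form.
apply: norm_positiveZ; first exact: ltW.
rewrite TE; apply: norm_positiveD; first exact: positive_op_form.
by apply: norm_positiveZ; [exact: ltW|exact: norm_positive_inner].
Qed.

End shift.
End positive_operators.

Section block_shift.
Variables (R : realType) (AA : cstarAlgType R) (E1 E2 : hilbertModType AA).

Lemma le_of_sqr_le (q p r : R) : 0 <= q -> 0 <= p -> 0 <= r ->
  q ^+ 2 <= r * (q * p) -> q <= r * p.
Proof.
move=> q0 p0 r0 h; have [->|qn] := eqVneq q 0; first exact: mulr_ge0.
have qp : 0 < q by rewrite lt0r qn.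
by rewrite -(ler_pM2l qp) -expr2; apply: le_trans h _; rewrite mulrCA.
Qed.

(** The Schur complement: y must solve y - T y = C^-1 (g - B^* A^-1 f) with
    T = C^-1 B^* A^-1 B, and then x = A^-1 (f - B y).  For the quadratic forms q
    of A and p of C, the hypothesis at (A^-1 B y, y) gives
    q (A^-1 B y) <= rho p y, and at (x, C^-1 B^* x) it gives
    p (C^-1 B^* x) <= rho q x. *)
Lemma block_surjective (A : adjointable E1 E1) (B : adjointable E2 E1)
    (C : adjointable E2 E2) (c rho : R) :
  invertible_op A -> invertible_op C -> 0 < c -> 0 <= rho -> rho < 1 ->
  (forall y, c * hnorm y ^+ 2 <= cnorm (inner (C y) y)) ->
  (forall x y, cnorm (inner (B y) x) ^+ 2
     <= rho * (cnorm (inner (A x) x) * cnorm (inner (C y) y))) ->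
  forall v, exists w, block_op A B (adjoint B) C w = v.
Proof.
move=> [SA [_ ASA]] [SC [_ CSC]] c0 r0 r1 hc hB [f g].
pose q x := cnorm (inner (A x) x); pose p y := cnorm (inner (C y) y).
have q0 x : 0 <= q x by exact: cnorm_ge0.
have p0 y : 0 <= p y by exact: cnorm_ge0.
have qp y : q (SA (B y)) <= rho * p y.
  apply: le_of_sqr_le => //; have := hB (SA (B y)) y.
  by rewrite -[X in inner X _]ASA.
have pq x : p (SC (adjoint B x)) <= rho * q x.
  have e : cnorm (inner (adjoint B x) (SC (adjoint B x)))
      = p (SC (adjoint B x)).
    by rewrite /p CSC.
  apply: le_of_sqr_le => //; have := hB x (SC (adjoint B x)).
  rewrite -(cnorm_star (inner (B _) x)) star_inner -(adjP (adjoint B)) e.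
  by rewrite [p _ * _]mulrC.
pose T y := SC (adjoint B (SA (B y))).
have TB : {morph T : x y / x - y} by move=> x y; rewrite /T !adj_sub.
have [M1 M10 hM1] := adjointable_bounded B.
have [M2 M20 hM2] := adjointable_bounded SA.
have [M3 M30 hM3] := adjointable_bounded (adjoint B).
have [M4 M40 hM4] := adjointable_bounded SC.
have TM y : hnorm (T y) <= M4 * (M3 * (M2 * M1)) * hnorm y.
  apply: le_trans (hM4 _) _; rewrite -!mulrA ler_wpM2l//.
  apply: le_trans (hM3 _) _; rewrite ler_wpM2l//.
  by apply: le_trans (hM2 _) _; rewrite ler_wpM2l.
pose v := SC (g - adjoint B (SA f)).
have pT n : p (iter n T v) <= rho ^+ n * p v.
  elim: n => [|n IH]; first by rewrite expr0 mul1r.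
  rewrite iterS exprS -mulrA; apply: le_trans (pq _) _; rewrite ler_wpM2l//.
  apply: le_trans (qp _) _; apply: le_trans IH.
  by rewrite ler_piMl// ltW.
have s1 : Num.sqrt rho < 1 by rewrite -sqrtr1 ltr_sqrt.
have [n|w hw] := @neumann R E2 (@hnorm R AA E2) (hnorm_complete E2) T _
  (Num.sqrt (p v / c)) (Num.sqrt rho) v TB TM (sqrtr_ge0 _) s1.
  have pc0 : 0 <= p v / c by rewrite divr_ge0// ltW.
  rewrite -ler_sqr ?nnegrE ?mulr_ge0 ?exprn_ge0 ?sqrtr_ge0 ?hnorm_ge0// exprMn.
  rewrite -exprM mulnC exprM (sqr_sqrtr pc0) (sqr_sqrtr r0) mulrAC
    ler_pdivlMr// mulrC.
  by apply: le_trans (hc _) _; rewrite [leRHS]mulrC pT.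
exists (SA (f - B w), w); congr pair => /=; first by rewrite ASA subrK.
have -> : C w = adjoint B (SA (B w)) + (g - adjoint B (SA f)).
  rewrite -{1}(subrK (T w) w) hw /v.
  have -> : SC (g - adjoint B (SA f)) + T w
      = SC ((g - adjoint B (SA f)) - (0 - adjoint B (SA (B w)))).
    by rewrite (adj_sub SC (_ - _)) (adj_sub SC 0) adj0 sub0r opprK.
  by rewrite CSC sub0r opprK addrC.
rewrite -[adj_adj B _]/(adjoint B _) (adj_sub SA) (adj_sub (adjoint B)).
by rewrite addrA subrK addrC subrK.
Qed.

End block_shift.

(** * The block operator *)

Section block_resolvent.
Variables (R : realType) (AA : cstarAlgType R) (E1 E2 : hilbertModType AA).
Variables (A : adjointable E1 E1) (B : adjointable E2 E1)
  (C : adjointable E2 E2).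
Variables (a c s : R).
Hypotheses (a_gt0 : 0 < a) (c_gt0 : 0 < c) (s_ge0 : 0 <= s) (s_lt1 : s < 1).
Hypotheses (A_ge : op_ge A (scalar_op E1 a%:C))
  (C_ge : op_ge C (scalar_op E2 c%:C)).
Hypothesis CBS : forall (x : E1) (y : E2),
  cnorm (inner (B y) x) ^+ 2
  <= s ^+ 2 * cnorm (inner (A x) x) * cnorm (inner (C y) y).
Let H := block_op A B (adjoint B) C.

(** With ka and kc from [shift_upper], the shifted blocks satisfy the hypothesis
    of [block_surjective] for rho = (s ka) (s kc). *)
Lemma block_real_surjective l :
  l < a * (1 - s) ^+ 2 -> l < c * (1 - s) ^+ 2 ->
  forall v, exists w, H w - cscale l%:C w = v.
Proof.
move=> lsa lsc v.
have s2 : (1 - s) ^+ 2 <= 1 by have := s_ge0; have := s_lt1; nra.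
have la : l < a by apply: lt_le_trans lsa _; rewrite ler_piMr// ltW.
have lc : l < c by apply: lt_le_trans lsc _; rewrite ler_piMr// ltW.
have [ka [ka0 ka1 hka]] := shift_upper A_ge la a_gt0 s_ge0 s_lt1 lsa.
have [kc [kc0 kc1 hkc]] := shift_upper C_ge lc c_gt0 s_ge0 s_lt1 lsc.
have rho0 : 0 <= (s * ka) * (s * kc) by rewrite !mulr_ge0.
have rho1 : (s * ka) * (s * kc) < 1.
  apply: le_lt_trans kc1; rewrite ler_piMl ?mulr_ge0//; exact: ltW.
have [|x y|w hw] := block_surjective (B := B) (shift_invertible A_ge la)
    (shift_invertible C_ge lc) (_ : 0 < c - l) rho0 rho1 (shift_lower C_ge lc) _
      v.
- by rewrite subr_gt0.
- apply: le_trans (CBS x y) _.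
  have -> : s * ka * (s * kc) = s ^+ 2 * (ka * kc) by rewrite expr2 mulrACA.
  rewrite -(mulrA (s ^+ 2) (cnorm _)) -(mulrA (s ^+ 2) (ka * kc)).
  by rewrite ler_wpM2l ?sqr_ge0// [leRHS]mulrACA ler_pM ?cnorm_ge0.
exists w; rewrite -hw; case: w {hw} => x y; congr pair.
  by rewrite /= addrAC.
by rewrite /= addrA.
Qed.

End block_resolvent.

Theorem theorem5p4 (R : realType) (AA : cstarAlgType R)
    (E1 E2 : hilbertModType AA)
    (A : adjointable E1 E1) (B : adjointable E2 E1) (C : adjointable E2 E2)
    (a c gamma : R)
    (a_gt0 : 0 < a) (c_gt0 : 0 < c)
    (A_sa : selfadjoint A) (A_ge : op_ge A (scalar_op E1 a%:C))
    (C_sa : selfadjoint C) (C_ge : op_ge C (scalar_op E2 c%:C))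
    (gamma_ge0 : 0 <= gamma) (gamma_lt1 : gamma < 1)
    (CBS : forall (x : E1) (y : E2),
       cnorm (inner (B y) x) ^+ 2
       <= gamma * cnorm (inner (A x) x) * cnorm (inner (C y) y)) :
  let H : adjointable (E1 * E2)%type (E1 * E2)%type :=
    block_op A B (adjoint B) C in
  let delta : R := Num.min (a * (1 - Num.sqrt gamma) ^+ 2)
                           (c * (1 - Num.sqrt gamma) ^+ 2) in
  [/\ 0 < delta,
      op_ge H (scalar_op (E1 * E2)%type delta%:C)
    & spectrum H `<=` [set z | delta%:C <= z]].
Proof.
move=> H delta.
set s := Num.sqrt gamma.
have s0 : 0 <= s by exact: sqrtr_ge0.
have s1 : s < 1 by rewrite -(sqrtr1 R) ltr_sqrt.
have sg : s ^+ 2 = gamma by rewrite sqr_sqrtr.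
have d0 : 0 < (1 - s) ^+ 2 by rewrite exprn_gt0// subr_gt0.
have delta_gt0 : 0 < delta.
  by rewrite /delta -/s lt_min (mulr_gt0 a_gt0 d0) (mulr_gt0 c_gt0 d0).
have sH : selfadjoint H by exact: block_selfadjoint.
have CBS' : forall (x : E1) (y : E2), cnorm (inner (B y) x) ^+ 2
  <= s ^+ 2 * cnorm (inner (A x) x) * cnorm (inner (C y) y).
  by move=> x y; rewrite sg.
have surj (z : R[i]) : ~ (delta%:C <= z) ->
    forall v, exists w, H w - cscale z w = v.
  move=> dz v; have [iz|iz] := eqVneq (complex.Im z) 0; last first.
    exact: (symmetric_nonreal_surjective v (selfadjoint_symmetric sH) iz).
  case: z iz dz => l i /= -> dz.
  have : l < delta by rewrite ltNge; apply/negP => h; apply: dz;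
    rewrite lecE /= eqxx.
  rewrite lt_min => /andP[la lc].
  exact: (block_real_surjective a_gt0 c_gt0 s0 s1 A_ge C_ge CBS' la lc v).
have inv (z : R[i]) : ~ (delta%:C <= z) ->
    invertible_op (sub_op H (scalar_op (E1 * E2)%type z)).
  move=> dz; apply: surjective_invertible => v.
    by have [w hw] := surj z dz v; exists w.
  have [|w hw] := surj (conjc z) _ v.
    by case: z dz => u w dz; rewrite lecE /= oppr_eq0 => h; apply: dz;
      rewrite lecE.
  by exists w; rewrite -hw (sH w).
have spec : spectrum H `<=` [set z | delta%:C <= z].
  by move=> z hz /=; apply: contrapT => /inv.
split=> //; split.
  move=> x; rewrite -[RHS]/(adjoint H x - cscale (conjc delta%:C) x).
  by rewrite conjc_real -sH.
move=> z hz /=; have : spectrum H (z + delta%:C).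
  move=> i; apply: hz; apply: invertible_op_ext i => x /=.
  by rewrite -!/(cscale _ x) cscaleD opprD addrA addrAC.
by move=> /spec /=; rewrite -subr_ge0 addrK.
Qed.
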